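(* Let $E=F^*\oplus\mathfrak g\oplus F$ be a flat standard Courant algebroid over $M$, with data $(\nabla,\mathcal R,H)$. Then $(F\oplus F^* )_H$ and $\mathfrak g$ form a matched pair of Courant algebroids, and $E$ is isomorphic to their matched sum. Here the $(F\oplus F^* )_H$-connection on $\mathfrak g$ is given by $\overrightarrow\nabla_{x+\xi}\mathbf r=\nabla_x\mathbf r$, and the $\mathfrak g$-connection on $(F\oplus F^* )_H$ is given by $\overleftarrow\nabla_{\mathbf r}(x\oplus\xi)=0\oplus2\mathcal Q(x,\mathbf r)$, for $x\in\Gamma(F)$, $\xi\in\Gamma(F^* )$, $\mathbf r\in\Gamma(\mathfrak g)$.
   Context: A Courant algebroid is a real vector bundle $E\to M$ with a fibrewise symmetric nondegenerate bilinear form $\langle\cdot,\cdot\rangle$, an $\mathbb R$-bilinear operation $\diamond$ on $\Gamma(E)$ and a bundle map $\rho:E\to TM$ (anchor) such that for all $\phi,\psi,\psi_1,\psi_2\in\Gamma(E)$, $f\in C^\infty(M)$: $\phi\diamond(\psi_1\diamond\psi_2)=(\phi\diamond\psi_1)\diamond\psi_2+\psi_1\diamond(\phi\diamond\psi_2)$; $\phi\diamond(f\psi)=\rho(\phi)[f]\psi+f(\phi\diamond\psi)$; $\phi\diamond\phi=\frac12\mathcal D\langle\phi,\phi\rangle$; $\rho(\phi)\langle\psi,\psi\rangle=2\langle\phi\diamond\psi,\psi\rangle$, where $\mathcal D=\rho^*d$, i.e. $\langle\mathcal Df,\phi\rangle=\rho(\phi)[f]$. Standard Courant algebroids. Let $F\subset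 TM$ be an integrable subbundle and $\mathfrak g\to M$ a bundle of quadratic Lie algebras with bracket $[\cdot,\cdot]_{\mathfrak g}$ and metric $\langle\cdot,\cdot\rangle_{\mathfrak g}$. A standard Courant algebroid on $F^*\oplus\mathfrak g\oplus F$ is a Courant algebroid structure with anchor $\rho(\xi+\mathbf r+x)=x$, metric $\langle\xi_1+\mathbf r_1+x_1,\xi_2+\mathbf r_2+x_2\rangle=\frac12\xi_1(x_2)+\frac12\xi_2(x_1)+\langle\mathbf r_1,\mathbf r_2\rangle_{\mathfrak g}$ and $\mathrm{pr}_{\mathfrak g}(\mathbf r_1\diamond\mathbf r_2)=[\mathbf r_1,\mathbf r_2]_{\mathfrak g}$. Such a structure is determined by an $F$-connection $\nabla$ on $\mathfrak g$, a bundle map $\mathcal R:\wedge^2F\to\mathfrak g$ and a 3-form $H\in\Gamma(\wedge^3F^* )$ such that $\nabla$ preserves $\langle\cdot,\cdot\rangle_{\mathfrak g}$ and $[\cdot,\cdot]_{\mathfrak g}$, $(\nabla_x\mathcal R(y,z)-\mathcal R([x,y],z))+\text{c.p.}=0$, $\nabla_x\nabla_y\mathbf r-\nabla_y\nabla_x\mathbf r-\nabla_{[x,y]}\mathbf r=[\mathcal R(x,y),\mathbf r]_{\mathfrak g}$, and $d_FH=\langle\mathcal R,\mathcal R\rangle_{\mathfrak g}$, where $\langle\mathcal R,\mathcal R\rangle_{\mathfrak g}(x_1,\dots,x_4)=\frac14\sum_{\sigma\in S_4}\mathrm{sgn}(\sigma)\langle\mathcal R(x_{\sigma(1)},x_{\sigma(2)}),\mathcal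 R(x_{\sigma(3)},x_{\sigma(4)})\rangle_{\mathfrak g}$ and $d_F$ is the leafwise de Rham differential. The bracket is $x_1\diamond x_2=H(x_1,x_2,\cdot)+\mathcal R(x_1,x_2)+[x_1,x_2]$; $\mathbf r_1\diamond\mathbf r_2=\mathcal P(\mathbf r_1,\mathbf r_2)+[\mathbf r_1,\mathbf r_2]_{\mathfrak g}$; $\xi_1\diamond\mathbf r_2=\mathbf r_1\diamond\xi_2=\xi_1\diamond\xi_2=0$; $x_1\diamond\xi_2=\mathcal L_{x_1}\xi_2$; $\xi_1\diamond x_2=-\mathcal L_{x_2}\xi_1+d_F(\xi_1(x_2))$; $x_1\diamond\mathbf r_2=-\mathbf r_2\diamond x_1=-2\mathcal Q(x_1,\mathbf r_2)+\nabla_{x_1}\mathbf r_2$; where $\mathcal P(\mathbf r_1,\mathbf r_2)(y)=2\langle\mathbf r_2,\nabla_y\mathbf r_1\rangle_{\mathfrak g}$ and $\mathcal Q(x,\mathbf r)(y)=\langle\mathbf r,\mathcal R(x,y)\rangle_{\mathfrak g}$ define $\mathcal P,\mathcal Q$ with values in $F^*$. $E$ is flat if $\langle\mathcal R,\mathcal R\rangle_{\mathfrak g}=0$ (so $d_FH=0$). $(F\oplus F^* )_H$ is the Courant algebroid on $F\oplus F^*$ twisted by $H$: metric $\frac12\xi_1(x_2)+\frac12\xi_2(x_1)$, anchor $x\oplus\xi\mapsto x$, bracket $(x_1\oplus\xi_1)\diamond(x_2\oplus\xi_2)=[x_1,x_2]\oplus(\mathcal L_{x_1}\xi_2-\iota_{x_2}d_F\xi_1+H(x_1,x_2,\cdot))$.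 The bundle $\mathfrak g$ is a Courant algebroid with zero anchor, bracket $[\cdot,\cdot]_{\mathfrak g}$ and metric $\langle\cdot,\cdot\rangle_{\mathfrak g}$. Matched pairs. For an anchored bundle $(E,\rho)$ an $E$-connection on $V$ is an $\mathbb R$-bilinear $\nabla:\Gamma(E)\otimes\Gamma(V)\to\Gamma(V)$ with $\nabla_{f\psi}v=f\nabla_\psi v$, $\nabla_\psi(fv)=(\rho(\psi)[f])v+f\nabla_\psi v$. Two Courant algebroids $E_1,E_2$ over the same base with an $E_1$-connection $\overrightarrow\nabla$ on $E_2$ and an $E_2$-connection $\overleftarrow\nabla$ on $E_1$ form a matched pair if the connections preserve the fibre metrics, satisfy $\overrightarrow\nabla_{\mathcal D_1f}\beta=0$, $\overleftarrow\nabla_{\mathcal D_2f}b=0$ for all functions $f$ and sections $b$ of $E_1$, $\beta$ of $E_2$, and satisfy, for all sections $a,a_i$ of $E_1$ and $\alpha,\alpha_i$ of $E_2$: (1) $\overleftarrow\nabla_\alpha(a_1\diamond_1a_2)-(\overleftarrow\nabla_\alpha a_1)\diamond_1a_2-a_1\diamond_1(\overleftarrow\nabla_\alpha a_2)-\overleftarrow\nabla_{\overrightarrow\nabla_{a_2}\alpha}a_1+\overleftarrow\nabla_{\overrightarrow\nabla_{a_1}\alpha}a_2=-\mho(\alpha,\omega_{12})-\frac12\mathcal D_1\langle\alpha,\omega_{12}\rangle_2$ with $\omega_{12}=\Omega(a_1,a_2)+\frac12\mathcal D_2\langle a_1,a_2\rangle_1$; (2) the same with the roles of $(E_1,\overrightarrow\nabla,\Omega)$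 and $(E_2,\overleftarrow\nabla,\mho)$ exchanged; (3) $\langle\overrightarrow R(a_1,a_2)\alpha_1,\alpha_2\rangle_2+\langle\overleftarrow R(\alpha_1,\alpha_2)a_1,a_2\rangle_1=0$, where $\overrightarrow R(a,b)=[\overrightarrow\nabla_a,\overrightarrow\nabla_b]-\overrightarrow\nabla_{a\diamond_1b}$, $\overleftarrow R(\alpha,\beta)=[\overleftarrow\nabla_\alpha,\overleftarrow\nabla_\beta]-\overleftarrow\nabla_{\alpha\diamond_2\beta}$; (4) $\overleftarrow\nabla_{\Omega(a_1,a_2)}a_3+$ cyclic permutations $=0$; (5) $\overrightarrow\nabla_{\mho(\alpha_1,\alpha_2)}\alpha_3+$ cyclic permutations $=0$. Here $\Omega,\mho$ are the skew maps with $\langle\gamma,\Omega(a,b)\rangle_2=\frac12(\langle\overleftarrow\nabla_\gamma a,b\rangle_1-\langle a,\overleftarrow\nabla_\gamma b\rangle_1)$ and $\langle c,\mho(\alpha,\beta)\rangle_1=\frac12(\langle\overrightarrow\nabla_c\alpha,\beta\rangle_2-\langle\alpha,\overrightarrow\nabla_c\beta\rangle_2)$. The matched sum is $E_1\oplus E_2$ with the direct sum metric, anchor $\rho_1+\rho_2$, and bracket $(a\oplus\alpha)\diamond(b\oplus\beta)=(a\diamond_1b+\overleftarrow\nabla_\alpha b-\overleftarrow\nabla_\beta a+\mho(\alpha,\beta)+\frac12\mathcal D_1\langle\alpha,\beta\rangle_2)\oplus(\alpha\diamond_2\beta+\overrightarrow\nabla_a\beta-\overrightarrow\nabla_b\alpha+\Omega(a,b)+\frac12\mathcal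 D_2\langle a,b\rangle_1)$. In the claim $E_1=(F\oplus F^* )_H$ and $E_2=\mathfrak g$. *)

(* Defs.v *)
From HB Require Import structures.
From mathcomp Require Import all_boot all_order all_fingroup all_algebra.
From mathcomp Require Import all_classical all_reals all_analysis.
Import Order.TTheory GRing.Theory Num.Theory.
Import numFieldNormedType.Exports.

Set Implicit Arguments.
Unset Strict Implicit.
Unset Printing Implicit Defensive.

Local Open Scope classical_set_scope.
Local Open Scope ring_scope.

(** * Smooth functions on open subsets of R^n *)

Lemma near_eq_differentiable (R : numFieldType) (V W : normedModType R)
    (f g : V -> W) (x : V) :
  (\near x, f x = g x) -> differentiable f x -> differentiable g x.
Proof.
move=> fg /diff_locallyP [cf ef].
have fgx : f x = g x by apply: nbhs_singleton fg.
have eg : g \o shift x = cst (g x) + 'd f x +o_ 0 id.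
  apply/eqaddoP => e e0.
  have /eqaddoP /(_ e e0) := ef.
  rewrite -fgx.
  have := fg; rewrite (near_shift 0) /= => fg0.
  apply: filter_app; apply: filterS fg0 => h /=; rewrite subr0 => fgh.
  by rewrite !fctE /= fgh.
have dE := diff_unique cf eg.
by apply/diff_locallyP; rewrite dE.
Qed.

Section Ck.
Variables (R : realType) (n : nat).
Implicit Types (U W : set 'rV[R]_n) (f g : 'rV[R]_n -> R).

(* f is Frechet differentiable on U and its directional derivatives are C^k'. *)
Fixpoint Ck (k : nat) U f : Prop :=
  if k is k'.+1 then
    (forall x, U x -> differentiable f x) /\
    (forall v, Ck k' U (fun x => 'D_v f x))
  else forall x, U x -> {for x, continuous f}.

Definition Cinf U f := forall k, Ck k U f.

Lemma Ck_bigcup (I : Type) (Us : I -> set 'rV[R]_n) k f :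
  (forall i, Ck k (Us i) f) -> Ck k [set x | exists i, Us i x] f.
Proof.
elim: k f => [|k IH] f /= H; first by move=> x [i Ui]; exact: (H i).
split; first by move=> x [i Ui]; apply: (H i).1.
by move=> v; apply: IH => i; apply: (H i).2.
Qed.

Lemma CkS k U W f : U `<=` W -> Ck k W f -> Ck k U f.
Proof.
move=> UW; elim: k f => [|k IH] f /=; first by move=> H x /UW; exact: H.
by move=> [H1 H2]; split=> [x /UW|v]; [exact: H1|exact/IH/H2].
Qed.

Lemma Ck_le k U f : Ck k.+1 U f -> Ck k U f.
Proof.
elim: k f => [|k IH] f /= [H1 H2].
  by move=> x Ux; apply: differentiable_continuous; exact: H1.
by split=> // v; apply: IH; exact: H2.
Qed.

Lemma Ck_eq k U f g : open U -> (forall x, U x -> f x = g x) ->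
  Ck k U f -> Ck k U g.
Proof.
move=> oU; elim: k f g => [|k IH] f g fg /=.
  all: have nfg x : U x -> \near x, f x = g x
    by move=> Ux; apply: filterS (open_nbhs_nbhs (conj oU Ux)) => y; exact: fg.
  move=> H x Ux.
  have := H x Ux; rewrite /prop_for /continuous_at -(fg x Ux).
  by apply: cvg_trans; have := nfg x Ux; apply: (@near_eq_cvg _ _ (nbhs x)).
move=> [H1 H2]; split.
  by move=> x Ux; apply: near_eq_differentiable (nfg x Ux) (H1 x Ux).
move=> v; apply: (IH _ _ _ (H2 v)) => x Ux.
by apply: near_eq_derive; exact: nfg.
Qed.

Lemma Ck_cst k U (c : R) : Ck k U (fun=> c).
Proof.
elim: k c => [|k IH] c /=; first by move=> x _; exact: cst_continuous.
split=> [x _|v]; first exact: differentiable_cst.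
have -> : (fun x => 'D_v (fun=> c) x) = (fun=> 0 : R) :> ('rV[R]_n -> R).
  by apply/funext => x; rewrite (derive_cst c).
exact: IH.
Qed.

Lemma CkD k U f g : open U -> Ck k U f -> Ck k U g ->
  Ck k U (fun x => f x + g x).
Proof.
move=> oU; elim: k f g => [|k IH] f g /=.
  by move=> cf cg x Ux; apply: continuousD; [exact: cf|exact: cg].
move=> [f1 f2] [g1 g2]; split.
  by move=> x Ux; apply: differentiableD; [exact: f1|exact: g1].
move=> v; apply: (Ck_eq oU _ (IH _ _ (f2 v) (g2 v))) => x Ux.
by rewrite -deriveD//; apply: diff_derivable; [exact: f1|exact: g1].
Qed.

Lemma CkM k U f g : open U -> Ck k U f -> Ck k U g ->
  Ck k U (fun x => f x * g x).
Proof.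
move=> oU; elim: k f g => [|k IH] f g.
  by move=> cf cg x Ux; apply: continuousM; [exact: cf|exact: cg].
move=> Hf Hg; have [f1 f2] := Hf; have [g1 g2] := Hg; split.
  by move=> x Ux; apply: differentiableM; [exact: f1|exact: g1].
move=> v.
have Hfg := CkD oU (IH _ _ (Ck_le Hf) (g2 v)) (IH _ _ (Ck_le Hg) (f2 v)).
apply: (Ck_eq oU _ Hfg) => x Ux.
by rewrite -[LHS]/(f x *: 'D_v g x + g x *: 'D_v f x) -deriveM//;
  apply: diff_derivable; [exact: f1|exact: g1].
Qed.

End Ck.

(** * Smooth manifolds *)

Record chart (R : realType) (n : nat) (T : topologicalType) := Chart {
  cdom : set T;
  cmap : T -> 'rV[R]_n;
  cinv : 'rV[R]_n -> T;
  cdom_open : open cdom;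
  cimg_open : open (cmap @` cdom);
  cmapK : {in cdom, cancel cmap cinv};
  cmap_continuous : {within cdom, continuous cmap};
  cinv_continuous : {within cmap @` cdom, continuous cinv} }.

(* The atlas need not be maximal. *)
Record manifold (R : realType) (n : nat) := Manifold {
  mpoint :> topologicalType;
  manifold_hausdorff : hausdorff_space mpoint;
  manifold_second_countable : @second_countable mpoint;
  atlas : set (chart R n mpoint);
  atlas_cover : forall p, exists2 c, atlas c & cdom c p;
  atlas_smooth : forall c c' j, atlas c -> atlas c' ->
    Cinf (cmap c @` (cdom c `&` cdom c')) (fun x => cmap c' (cinv c x) 0 j) }.

Arguments atlas {R n} m.

Section SmoothFunctions.
Variables (R : realType) (n : nat) (M : manifold R n).
Implicit Types (W : set M) (f g : M -> R).

Definition smooth_on W f := forall c, atlas M c ->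
  Cinf (cmap c @` (cdom c `&` W)) (f \o cinv c).

Definition smooth f := smooth_on setT f.

Lemma chart_open (c : chart R n M) W : open W -> open (cmap c @` (cdom c `&` W)).
Proof.
move=> oW.
have -> : cmap c @` (cdom c `&` W) = cmap c @` cdom c `&` cinv c @^-1` W.
  apply/seteqP; split=> [_ [p [cp Wp] <-]|_ [[p cp <-]]] /=.
    by split; [exists p|rewrite /= cmapK// inE].
  by rewrite cmapK ?inE// => Wp; exists p.
have /open_subspaceP [V oV VE] :=
  (continuousP _).1 (@cinv_continuous _ _ _ c) W oW.
by rewrite setIC -VE; apply: openI => //; exact: cimg_open.
Qed.

Lemma smooth_onS W W' f : W `<=` W' -> smooth_on W' f -> smooth_on W f.
Proof.
move=> WW' sf c ac k; apply: CkS (sf c ac k) => _ [p [cp Wp] <-].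
by exists p => //; split=> //; exact: WW'.
Qed.

Lemma smooth_on_eq W f g : open W -> (forall p, W p -> f p = g p) ->
  smooth_on W f -> smooth_on W g.
Proof.
move=> oW fg sf c ac k; apply: (Ck_eq _ _ (sf c ac k)); first exact: chart_open.
by move=> _ [p [cp Wp] <-] /=; rewrite cmapK ?inE//; exact: fg.
Qed.

Lemma smooth_on_cover W f :
  (forall p, W p -> exists W', [/\ W' p & smooth_on W' f]) -> smooth_on W f.
Proof.
move=> H c ac k.
pose I := {W' : set M | smooth_on W' f}.
apply: (@CkS _ _ _ _
  [set x | exists i : I, (cmap c @` (cdom c `&` sval i)) x]).
  move=> _ [p [cp Wp] <-]; have [W' [W'p sW']] := H p Wp.
  by exists (exist _ W' sW'), p.
by apply: Ck_bigcup => -[W' sW'] /=; exact: sW'.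
Qed.

Lemma smooth_on_cst W (c : R) : smooth_on W (fun=> c).
Proof. by move=> h _ k; exact: Ck_cst. Qed.

Lemma smooth_onD W f g : open W -> smooth_on W f -> smooth_on W g ->
  smooth_on W (fun p => f p + g p).
Proof.
by move=> oW sf sg c ac k; apply: CkD (sf c ac k) (sg c ac k); exact: chart_open.
Qed.

Lemma smooth_onM W f g : open W -> smooth_on W f -> smooth_on W g ->
  smooth_on W (fun p => f p * g p).
Proof.
by move=> oW sf sg c ac k; apply: CkM (sf c ac k) (sg c ac k); exact: chart_open.
Qed.

Lemma smooth_on_sum W (I : Type) (r : seq I) (F : I -> M -> R) : open W ->
  (forall i, smooth_on W (F i)) -> smooth_on W (fun p => \sum_(i <- r) F i p).
Proof.
move=> oW sF; elim: r => [|i r IH].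
  by under eq_fun do rewrite big_nil; exact: smooth_on_cst.
by under eq_fun do rewrite big_cons; exact: smooth_onD.
Qed.

Record smoothfun := SmoothFun { sfun :> M -> R; sfunP : smooth sfun }.

Lemma smoothfun_eq (f g : smoothfun) : f =1 g -> f = g.
Proof.
case: f g => [f sf] [g sg] /= /funext fg; subst g.
by congr SmoothFun; exact: Prop_irrelevance.
Qed.

HB.instance Definition _ := gen_eqMixin smoothfun.
HB.instance Definition _ := gen_choiceMixin smoothfun.
Definition smooth_cst (c : R) : smoothfun := SmoothFun (@smooth_on_cst setT c).

End SmoothFunctions.

Arguments smooth_cst {R n} M c.

Section SmoothRing.
Variables (R : realType) (n : nat) (M : manifold R n).
Local Notation smoothfun := (smoothfun M).
Implicit Types (f g h : smoothfun).

Let opp_smooth f : smooth (fun p => - f p).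
Proof.
apply: (@smooth_on_eq _ _ M setT (fun p => -1 * f p) _ openT).
  by move=> p _; rewrite mulN1r.
by apply: smooth_onM; [exact: openT|exact: smooth_on_cst|exact: sfunP].
Qed.

Let oppf f : smoothfun := SmoothFun (opp_smooth f).
Let addf f g : smoothfun :=
  SmoothFun (smooth_onD openT (@sfunP _ _ _ f) (@sfunP _ _ _ g)).
Let mulf f g : smoothfun :=
  SmoothFun (smooth_onM openT (@sfunP _ _ _ f) (@sfunP _ _ _ g)).

Let addfA : associative addf.
Proof. by move=> f g h; apply: smoothfun_eq => p; exact: addrA. Qed.
Let addfC : commutative addf.
Proof. by move=> f g; apply: smoothfun_eq => p; exact: addrC. Qed.
Let add0f : left_id (smooth_cst M 0) addf.
Proof. by move=> f; apply: smoothfun_eq => p; exact: add0r. Qed.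
Let addNf : left_inverse (smooth_cst M 0) oppf addf.
Proof. by move=> f; apply: smoothfun_eq => p; exact: addNr. Qed.
Let mulfA : associative mulf.
Proof. by move=> f g h; apply: smoothfun_eq => p; exact: mulrA. Qed.
Let mul1f : left_id (smooth_cst M 1) mulf.
Proof. by move=> f; apply: smoothfun_eq => p; exact: mul1r. Qed.
Let mulf1 : right_id (smooth_cst M 1) mulf.
Proof. by move=> f; apply: smoothfun_eq => p; exact: mulr1. Qed.
Let mulfDl : left_distributive mulf addf.
Proof. by move=> f g h; apply: smoothfun_eq => p; exact: mulrDl. Qed.
Let mulfDr : right_distributive mulf addf.
Proof. by move=> f g h; apply: smoothfun_eq => p; exact: mulrDr. Qed.
Let mulfC : commutative mulf.
Proof. by move=> f g; apply: smoothfun_eq => p; exact: mulrC. Qed.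

HB.instance Definition _ :=
  GRing.isZmodule.Build smoothfun addfA addfC add0f addNf.
HB.instance Definition _ :=
  GRing.Zmodule_isPzRing.Build smoothfun mulfA mul1f mulf1 mulfDl mulfDr.
HB.instance Definition _ :=
  GRing.PzRing_hasCommutativeMul.Build smoothfun mulfC.

End SmoothRing.


(** * Vector bundles and their sections *)

(* A local frame; [fvec p] is meaningful only for [p] in [fdom]. *)
Record frame (R : realType) (T : Type) (V : T -> vectType R) := Frame {
  fdom : set T;
  frank : nat;
  fvec : forall p, frank.-tuple (V p) }.

(* A vector bundle is a family of finite-dimensional real vector spaces with a
   covering by local frames (equivalently, local trivialisations) whose
   transition functions are smooth; its rank may differ between components. *)
Record vbundle (R : realType) (n : nat) (M : manifold R n) := VBundle {
  fib :> M -> vectType R;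
  frames : set (frame fib);
  frame_open : forall e, frames e -> open (fdom e);
  frame_basis : forall e p, frames e -> fdom e p -> basis_of fullv (fvec e p);
  frame_cover : forall p, exists2 e, frames e & fdom e p;
  frame_smooth : forall e e' (i : 'I_(frank e)) (j : 'I_(frank e')), frames e -> frames e' ->
    smooth_on (fdom e `&` fdom e')
      (fun p => coord (fvec e' p) j (fvec e p)`_i) }.

Arguments frames {R n M} v.

Section Sections.
Variables (R : realType) (n : nat) (M : manifold R n) (V : vbundle M).

Definition smooth_section (s : forall p, V p) :=
  forall e i, frames V e -> smooth_on (fdom e) (fun p => coord (fvec e p) i (s p)).

Record sect := Sect { sval :> forall p, V p; svalP : smooth_section sval }.

Implicit Types (s t : sect) (f : smoothfun M).

Lemma sect_eq s t : (forall p, s p = t p) -> s = t.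
Proof.
case: s t => [s ss] [t st] /= e.
have {}e : s = t by exact: functional_extensionality_dep.
by subst t; congr Sect; exact: Prop_irrelevance.
Qed.

HB.instance Definition _ := gen_eqMixin sect.
HB.instance Definition _ := gen_choiceMixin sect.

Let zero_smooth : smooth_section (fun p => 0).
Proof.
move=> e i Ve; apply: smooth_on_eq (smooth_on_cst _ 0); first exact: frame_open.
by move=> p _; rewrite linear0.
Qed.

Let add_smooth s t : smooth_section (fun p => s p + t p).
Proof.
move=> e i Ve.
have oe := frame_open Ve.
have st := smooth_onD oe (svalP s i Ve) (svalP t i Ve).
by apply: smooth_on_eq st => // p _; rewrite linearD.
Qed.

Let scale_smooth f s : smooth_section (fun p => f p *: s p).
Proof.
move=> e i Ve.
have oe := frame_open Ve.
have fs := smooth_onM oe (smooth_onS (@subsetT _ _) (sfunP f)) (svalP s i Ve).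
by apply: smooth_on_eq fs => // p _; rewrite linearZ.
Qed.

Let zeros := Sect zero_smooth.
Let adds s t := Sect (add_smooth s t).
Let scales f s := Sect (scale_smooth f s).
Let opps s := scales (smooth_cst M (-1)) s.

Let addsA : associative adds.
Proof. by move=> r s t; apply: sect_eq => p; exact: addrA. Qed.
Let addsC : commutative adds.
Proof. by move=> s t; apply: sect_eq => p; exact: addrC. Qed.
Let add0s : left_id zeros adds.
Proof. by move=> s; apply: sect_eq => p; exact: add0r. Qed.
Let addNs : left_inverse zeros opps adds.
Proof. by move=> s; apply: sect_eq => p /=; rewrite scaleN1r addNr. Qed.

HB.instance Definition _ := GRing.isZmodule.Build sect addsA addsC add0s addNs.

Let scalesA f g s : scales f (scales g s) = scales (f * g) s.
Proof. by apply: sect_eq => p; exact: scalerA. Qed.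
Let scale1s : left_id 1 scales.
Proof. by move=> s; apply: sect_eq => p; exact: scale1r. Qed.
Let scalesDr : right_distributive scales +%R.
Proof. by move=> f s t; apply: sect_eq => p; exact: scalerDr. Qed.
Let scalesDl s : {morph scales^~ s : f g / f + g}.
Proof. by move=> f g; apply: sect_eq => p; exact: scalerDl. Qed.

HB.instance Definition _ := GRing.Zmodule_isLmodule.Build (smoothfun M) sect
  scalesA scale1s scalesDr scalesDl.

End Sections.

Notation "'Γ' V" := (sect V) (at level 10, V at level 8).

(** * Dual bundles and direct sums *)

Lemma memv_dim_free (R : realType) (V : vectType R) r (X : r.-tuple V) :
  free X -> r = dim V -> basis_of fullv X.
Proof.
by move=> fX rV; rewrite basisEfree fX subvf /= dimvf size_tuple rV.
Qed.

Lemma basis_dim (R : realType) (V : vectType R) r (X : r.-tuple V) :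
  basis_of fullv X -> r = dim V.
Proof. by move=> bX; rewrite -dimvf (size_basis bX). Qed.

Section DualBasis.
Variables (R : realType) (V : vectType R) (r : nat) (X : r.-tuple V).

Definition dual_tuple : r.-tuple 'Hom(V, R^o) :=
  [tuple linfun (coord X i : V -> R^o) | i < r].

Hypothesis bX : basis_of fullv X.

Lemma dual_tupleE (i : 'I_r) v : dual_tuple`_i v = coord X i v.
Proof. by rewrite -tnth_nth tnth_mktuple lfunE. Qed.

Lemma dual_basis : basis_of fullv dual_tuple.
Proof.
apply: memv_dim_free; last first.
  by rewrite (basis_dim bX) -[RHS]dimvf dimvf /dim /= muln1.
apply/freeP => k k0 i.
have := congr1 (fun h : 'Hom(V, R^o) => h X`_i) k0.
rewrite zero_lfunE sum_lfunE (bigD1 i)//= big1 ?addr0.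
  by rewrite scale_lfunE dual_tupleE coord_free ?(basis_free bX)// eqxx scaler1.
by move=> j ji; rewrite scale_lfunE dual_tupleE coord_free ?(basis_free bX)//
  eq_sym (negbTE ji) scaler0.
Qed.

Lemma coord_dual i (h : 'Hom(V, R^o)) : coord dual_tuple i h = h X`_i.
Proof.
rewrite [in RHS](coord_basis dual_basis (memvf h)) sum_lfunE (bigD1 i)//= big1.
  by rewrite addr0 scale_lfunE dual_tupleE coord_free ?(basis_free bX)// eqxx scaler1.
by move=> j ji; rewrite scale_lfunE dual_tupleE coord_free ?(basis_free bX)//
  eq_sym (negbTE ji) scaler0.
Qed.

End DualBasis.

Section SumBasis.
Variables (R : realType) (V W : vectType R) (r q : nat).
Variables (X : r.-tuple V) (Y : q.-tuple W).

Definition sum_tuple : (r + q).-tuple (V * W)%type :=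
  [tuple match fintype.split i with
         | inl j => (X`_j, 0) | inr j => (0, Y`_j) end | i < r + q].

Lemma sum_tuplel (j : 'I_r) : sum_tuple`_(lshift q j) = (X`_j, 0).
Proof. by rewrite -tnth_nth tnth_mktuple (unsplitK (inl j)). Qed.

Lemma sum_tupler (j : 'I_q) : sum_tuple`_(rshift r j) = (0, Y`_j).
Proof. by rewrite -tnth_nth tnth_mktuple (unsplitK (inr j)). Qed.

Lemma sum_tuple_comb (k : 'I_(r + q) -> R) :
  \sum_i k i *: sum_tuple`_i =
  (\sum_i k (lshift q i) *: X`_i, \sum_i k (rshift r i) *: Y`_i).
Proof.
have sum1 I (s : seq I) (F : I -> (V * W)%type) :
    (\sum_(i <- s) F i).1 = \sum_(i <- s) (F i).1 by exact: big_morph.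
have sum2 I (s : seq I) (F : I -> (V * W)%type) :
    (\sum_(i <- s) F i).2 = \sum_(i <- s) (F i).2 by exact: big_morph.
rewrite big_split_ord /=.
under eq_bigr do rewrite sum_tuplel.
under [X in _ + X]eq_bigr do rewrite sum_tupler.
apply: injective_projections => /=; rewrite ?sum1 ?sum2.
  by rewrite [X in _ + X]big1 ?addr0// => i _; exact: scaler0.
by rewrite big1 ?add0r// => i _; exact: scaler0.
Qed.

Hypotheses (bX : basis_of fullv X) (bY : basis_of fullv Y).

Lemma sum_basis : basis_of fullv sum_tuple.
Proof.
apply: memv_dim_free; last by rewrite (basis_dim bX) (basis_dim bY).
apply/freeP => k; rewrite sum_tuple_comb => -[kX kY] i.
have /freeP/(_ _ kX) {}kX := basis_free bX.
have /freeP/(_ _ kY) {}kY := basis_free bY.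
by rewrite -(splitK i); case: (fintype.split i) => j /=.
Qed.

Lemma coord_sum i (u : (V * W)%type) : coord sum_tuple i u =
  match fintype.split i with inl j => coord X j u.1 | inr j => coord Y j u.2 end.
Proof.
pose k i := match fintype.split i with
  inl j => coord X j u.1 | inr j => coord Y j u.2 end.
have uE : u = \sum_i k i *: sum_tuple`_i.
  rewrite sum_tuple_comb [LHS]surjective_pairing; congr pair.
    rewrite [LHS](coord_basis bX (memvf _)); apply: eq_bigr => j _.
    by rewrite /k (unsplitK (inl j)).
  rewrite [LHS](coord_basis bY (memvf _)); apply: eq_bigr => j _.
  by rewrite /k (unsplitK (inr j)).
by rewrite [in LHS]uE coord_sum_free ?(basis_free sum_basis).
Qed.

End SumBasis.

Section DualBundle.
Variables (R : realType) (n : nat) (M : manifold R n) (V : vbundle M).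

Definition dual_fib (p : M) : vectType R := 'Hom(V p, R^o).

Definition dual_frame (e : frame V) : frame dual_fib :=
  @Frame R M dual_fib (fdom e) (frank e) (fun p => dual_tuple (fvec e p)).

Definition dual_frames : set (frame dual_fib) := dual_frame @` frames V.

Let dual_open e : dual_frames e -> open (fdom e).
Proof. by move=> [f Vf <-]; exact: frame_open. Qed.

Let dual_is_basis e p :
  dual_frames e -> fdom e p -> basis_of fullv (fvec e p).
Proof. by move=> [f Vf <-] fp; exact/dual_basis/frame_basis. Qed.

Let dual_cover p : exists2 e, dual_frames e & fdom e p.
Proof.
by have [f Vf fp] := frame_cover V p; exists (dual_frame f) => //; exists f.
Qed.

Let dual_smooth e e' (i : 'I_(frank e)) (j : 'I_(frank e')) : dual_frames e -> dual_frames e' ->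
  smooth_on (fdom e `&` fdom e') (fun p => coord (fvec e' p) j (fvec e p)`_i).
Proof.
move=> [f Vf ef] [f' Vf' ef']; subst e e' => /=.
have := @frame_smooth _ _ _ V f' f j i Vf' Vf; rewrite setIC.
apply: smooth_on_eq; first by apply: openI; exact: frame_open.
by move=> p [fp f'p] /=; rewrite coord_dual ?dual_tupleE//; exact: frame_basis.
Qed.

Definition dual : vbundle M :=
  VBundle dual_open dual_is_basis dual_cover dual_smooth.

End DualBundle.

Section SumBundle.
Variables (R : realType) (n : nat) (M : manifold R n) (V W : vbundle M).

Definition dsum_fib (p : M) : vectType R := (V p * W p)%type.

Definition dsum_frame (e : frame V) (f : frame W) : frame dsum_fib :=
  @Frame R M dsum_fib (fdom e `&` fdom f) (frank e + frank f)
    (fun p => sum_tuple (fvec e p) (fvec f p)).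

Definition dsum_frames : set (frame dsum_fib) :=
  [set h | exists e f, [/\ frames V e, frames W f & h = dsum_frame e f]].

Let dsum_open e : dsum_frames e -> open (fdom e).
Proof. by move=> [f [g [Vf Wg ->]]]; apply: openI; exact: frame_open. Qed.

Let dsum_is_basis e p :
  dsum_frames e -> fdom e p -> basis_of fullv (fvec e p).
Proof.
by move=> [f [g [Vf Wg ->]]] [fp gp]; apply: sum_basis; exact: frame_basis.
Qed.

Let dsum_cover p : exists2 e, dsum_frames e & fdom e p.
Proof.
have [f Vf fp] := frame_cover V p; have [g Wg gp] := frame_cover W p.
by exists (dsum_frame f g) => //; exists f, g.
Qed.

Let dsum_smooth e e' (i : 'I_(frank e)) (j : 'I_(frank e')) : dsum_frames e -> dsum_frames e' ->
  smooth_on (fdom e `&` fdom e') (fun p => coord (fvec e' p) j (fvec e p)`_i).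
Proof.
move=> [f [g [Vf Wg ef]]] [f' [g' [Vf' Wg' ef']]]; subst e e' => /=.
set D := (X in smooth_on X).
have oD : open D by do !apply: openI; exact: frame_open.
have E k : (forall p, D p ->
    k p = coord (sum_tuple (fvec f' p) (fvec g' p)) j
                (sum_tuple (fvec f p) (fvec g p))`_i) ->
    smooth_on D k ->
    smooth_on D (fun p => coord (sum_tuple (fvec f' p) (fvec g' p)) j
                                (sum_tuple (fvec f p) (fvec g p))`_i).
  exact: smooth_on_eq.
case: (fintype.split j) (splitK j) => j' /= jE; subst j;
  case: (fintype.split i) (splitK i) => i' /= iE; subst i.
- apply: (E (fun p => coord (fvec f' p) j' (fvec f p)`_i')); last first.
    apply: smooth_onS (frame_smooth i' j' Vf Vf').
    by move=> p [[]? ? []].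
  move=> p [[fp gp] [f'p g'p]]; rewrite coord_sum; try exact: frame_basis.
  by rewrite (unsplitK (inl j')) sum_tuplel.
- apply: (E (fun=> 0)); last exact: smooth_on_cst.
  move=> p [[fp gp] [f'p g'p]]; rewrite coord_sum; try exact: frame_basis.
  by rewrite (unsplitK (inl j')) sum_tupler linear0.
- apply: (E (fun=> 0)); last exact: smooth_on_cst.
  move=> p [[fp gp] [f'p g'p]]; rewrite coord_sum; try exact: frame_basis.
  by rewrite (unsplitK (inr j')) sum_tuplel linear0.
- apply: (E (fun p => coord (fvec g' p) j' (fvec g p)`_i')); last first.
    apply: smooth_onS (frame_smooth i' j' Wg Wg').
    by move=> p [[]? ? []].
  move=> p [[fp gp] [f'p g'p]]; rewrite coord_sum; try exact: frame_basis.
  by rewrite (unsplitK (inr j')) sum_tupler.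
Qed.

Definition dsum : vbundle M :=
  VBundle dsum_open dsum_is_basis dsum_cover dsum_smooth.

Let pair_smooth (s : Γ V) (t : Γ W) :
  smooth_section (V := dsum) (fun p => (s p, t p) : dsum p).
Proof.
move=> e i [f [g [Vf Wg ef]]]; subst e => /=.
set D := (X in smooth_on X).
have oD : open D by apply: openI; exact: frame_open.
case: (fintype.split i) (splitK i) => i' /= iE; subst i.
  have := smooth_onS (@subIsetl _ (fdom f) (fdom g)) (svalP s i' Vf).
  apply: smooth_on_eq => // p [fp gp].
  by rewrite coord_sum; try exact: frame_basis; rewrite (unsplitK (inl i')).
have := smooth_onS (@subIsetr _ (fdom f) (fdom g)) (svalP t i' Wg).
apply: smooth_on_eq => // p [fp gp].
by rewrite coord_sum; try exact: frame_basis; rewrite (unsplitK (inr i')).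
Qed.

Definition spair (s : Γ V) (t : Γ W) : Γ dsum := Sect (pair_smooth s t).

Let fst_smooth (s : Γ dsum) : smooth_section (V := V) (fun p => (s p).1).
Proof.
move=> f i Vf; apply: smooth_on_cover => p fp.
have [g Wg gp] := frame_cover W p.
exists (fdom f `&` fdom g); split=> //.
have Se : frames dsum (dsum_frame f g) by exists f, g.
have := @svalP R n M dsum s (dsum_frame f g) (lshift (frank g) i) Se.
apply: smooth_on_eq; first by apply: openI; exact: frame_open.
move=> q [fq gq] /=; rewrite coord_sum; try exact: frame_basis.
by rewrite (unsplitK (inl i)).
Qed.

Let snd_smooth (s : Γ dsum) : smooth_section (V := W) (fun p => (s p).2).
Proof.
move=> g i Wg; apply: smooth_on_cover => p gp.
have [f Vf fp] := frame_cover V p.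
exists (fdom f `&` fdom g); split=> //.
have Se : frames dsum (dsum_frame f g) by exists f, g.
have := @svalP R n M dsum s (dsum_frame f g) (rshift (frank f) i) Se.
apply: smooth_on_eq; first by apply: openI; exact: frame_open.
move=> q [fq gq] /=; rewrite coord_sum; try exact: frame_basis.
by rewrite (unsplitK (inr i)).
Qed.

Definition sfst (s : Γ dsum) : Γ V := Sect (fst_smooth s).
Definition ssnd (s : Γ dsum) : Γ W := Sect (snd_smooth s).

End SumBundle.

(** * Tangent vectors, anchors and fibre metrics *)

(* T_p M, as the derivations at p of the algebra of smooth functions. *)
Record tangent (R : realType) (n : nat) (M : manifold R n) (p : M) := Tangent {
  tder :> smoothfun M -> R;
  tderD : forall f g, tder (f + g) = tder f + tder g;
  tderZ : forall c f, tder (smooth_cst M c * f) = c * tder f;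
  tderM : forall f g, tder (f * g) = tder f * g p + f p * tder g }.

(* A bundle map V -> TM; here and below, a fibrewise linear map is smooth when
   it sends smooth sections to smooth sections. *)
Record anchor (R : realType) (n : nat) (M : manifold R n) (V : vbundle M) :=
  Anchor {
  avec :> forall p, V p -> tangent p;
  anchor_linear : forall p a (u v : V p) f,
    avec (a *: u + v) f = a * avec u f + avec v f;
  anchor_smooth : forall (s : Γ V) f, smooth (fun p => avec (s p) f) }.

Definition along (R : realType) (n : nat) (M : manifold R n) (V : vbundle M)
  (A : anchor V) (s : Γ V) (f : smoothfun M) : smoothfun M :=
  SmoothFun (anchor_smooth A s f).

Record bmetric (R : realType) (n : nat) (M : manifold R n) (V : vbundle M) :=
  BMetric {
  bform :> forall p, V p -> V p -> R;
  bform_linear : forall p (v : V p), scalar (fun u : V p => bform u v);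
  bform_sym : forall p (u v : V p), bform u v = bform v u;
  bform_nondegenerate : forall p (u : V p), (forall v, bform u v = 0) -> u = 0;
  bform_smooth : forall s t : Γ V, smooth (fun p => bform (s p) (t p)) }.

Lemma bform0l (R : realType) (n : nat) (M : manifold R n) (V : vbundle M)
  (m : bmetric V) p v : m p 0 v = 0.
Proof.
have := @bform_linear _ _ _ _ m p v 1 0 0.
rewrite scaler0 addr0 mul1r => /eqP.
by rewrite eq_sym -[X in _ == X]addr0 (inj_eq (addrI _)) => /eqP.
Qed.

Definition mpair (R : realType) (n : nat) (M : manifold R n) (V : vbundle M)
  (m : bmetric V) (s t : Γ V) : smoothfun M := SmoothFun (bform_smooth m s t).

Section DirectSums.
Variables (R : realType) (n : nat) (M : manifold R n) (V W : vbundle M).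

Definition half : smoothfun M := smooth_cst M 2^-1.

Let tangent0 (p : M) : tangent p.
Proof.
exists (fun=> 0) => [_ _|c _|f g]; first by rewrite addr0.
  by rewrite mulr0.
by rewrite mul0r mulr0 addr0.
Defined.

Definition zero_anchor : anchor V.
Proof.
exists (fun p _ => tangent0 p) => [p a u v f|s f] /=.
  by rewrite mulr0 addr0.
exact: smooth_on_cst.
Defined.

Definition tangent_add (p : M) (X Y : tangent p) : tangent p.
Proof.
exists (fun f => X f + Y f) => [f g|c f|f g]; rewrite ?tderD ?tderZ ?tderM.
- by rewrite addrACA.
- by rewrite mulrDr.
- by rewrite mulrDl mulrDr addrACA.
Defined.

Definition dsum_anchor (A : anchor V) (B : anchor W) : anchor (dsum V W).
Proof.
exists (fun p (u : dsum V W p) => tangent_add (A p u.1) (B p u.2)).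
  by move=> p a u v f /=; rewrite !anchor_linear mulrDr addrACA.
move=> s f; apply: (smooth_onD openT).
  exact: (anchor_smooth A (sfst s) f).
exact: (anchor_smooth B (ssnd s) f).
Defined.

Definition dsum_metric (m : bmetric V) (m' : bmetric W) : bmetric (dsum V W).
Proof.
exists (fun p (u v : dsum V W p) => m p u.1 v.1 + m' p u.2 v.2).
- by move=> p v a u u' /=; rewrite !bform_linear mulrDr addrACA.
- by move=> p u v; rewrite bform_sym [X in _ + X]bform_sym.
- move=> p [u1 u2] /= u0; congr pair.
    apply: (@bform_nondegenerate _ _ _ _ m p) => v.
    by have := u0 (v, 0); rewrite /= [X in _ + X]bform_sym bform0l addr0.
  apply: (@bform_nondegenerate _ _ _ _ m' p) => v.
  by have := u0 (0, v); rewrite /= bform_sym bform0l add0r.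
- move=> s t; apply: (smooth_onD openT).
    exact: (bform_smooth m (sfst s) (sfst t)).
  exact: (bform_smooth m' (ssnd s) (ssnd t)).
Defined.

Lemma dual_separates p (x : V p) : (forall h : dual V p, h x = 0) -> x = 0.
Proof.
move=> hx; rewrite (coord_vbasis (memvf x)) big1// => i _.
have := hx (linfun (coord (vbasis fullv) i : V p -> R^o)).
by rewrite lfunE /= => ->; rewrite scale0r.
Qed.

Let eval_smooth (xi : Γ (dual V)) (x : Γ V) : smooth (fun p => xi p (x p) : R).
Proof.
apply: smooth_on_cover => p _.
have [e Ve ep] := frame_cover V p.
exists (fdom e); split=> //.
have oe := frame_open Ve.
have De : frames (dual V) (dual_frame e) by exists e.
pose F i q := coord (dual_tuple (fvec e q)) i (xi q) * coord (fvec e q) i (x q).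
have : smooth_on (fdom e) (fun q => \sum_i F i q).
  apply: smooth_on_sum => // i; apply: smooth_onM => //.
    exact: (@svalP _ _ _ _ xi (dual_frame e) i De).
  exact: (svalP x i Ve).
apply: smooth_on_eq => // q eq.
have be := frame_basis Ve eq.
rewrite [in RHS](coord_basis be (memvf (x q))) linear_sum.
by apply: eq_bigr => i _; rewrite linearZ /F coord_dual// mulrC.
Qed.

Definition eval (xi : Γ (dual V)) (x : Γ V) : smoothfun M :=
  SmoothFun (eval_smooth xi x).

Definition hyper_metric : bmetric (dsum V (dual V)).
Proof.
exists (fun p (u v : dsum V (dual V) p) =>
  2^-1 * (u.2 v.1 : R) + 2^-1 * (v.2 u.1 : R)).
- move=> p v a u u' /=; rewrite add_lfunE scale_lfunE linearP /=.
  by rewrite !mulrDr addrACA ![2^-1 * (a *: _)]mulrCA -mulrDr.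
- by move=> p u v; rewrite addrC.
- move=> p [x xi] /= u0.
  have n2 : 2^-1 != 0 :> R by rewrite invr_neq0.
  congr pair.
    apply: dual_separates => h; have := u0 (0, h).
    rewrite /= linear0 mulr0 add0r => /eqP.
    by rewrite mulf_eq0 (negbTE n2) => /eqP.
  apply/lfunP => y; have := u0 (y, 0).
  rewrite /= zero_lfunE mulr0 addr0 => /eqP.
  by rewrite mulf_eq0 (negbTE n2) => /eqP ->; rewrite zero_lfunE.
- move=> s t; apply: (smooth_onD openT).
    apply: (smooth_onM openT); first exact: smooth_on_cst.
    exact: (eval_smooth (ssnd s) (sfst t)).
  apply: (smooth_onM openT); first exact: smooth_on_cst.
  exact: (eval_smooth (ssnd t) (sfst s)).
Defined.

End DirectSums.

Arguments half {R n M}.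
Arguments zero_anchor {R n M} V.
Arguments hyper_metric {R n M} V.

Section Representation.
Variables (R : realType) (n : nat) (M : manifold R n) (V : vbundle M).

(* [covec Phi] is the section of the dual bundle with value [Phi y] on each
   section y; it exists and is unique as soon as Phi is C^oo(M)-linear, which
   is the case wherever it is used below. *)
Definition covec (Phi : Γ V -> smoothfun M) : Γ (dual V) :=
  xget 0 [set xi | forall y, eval xi y = Phi y].

(* The section representing Phi through the metric, under the same proviso. *)
Definition riesz (m : bmetric V) (Phi : Γ V -> smoothfun M) : Γ V :=
  xget 0 [set s | forall t, mpair m s t = Phi t].

End Representation.

(** * Courant algebroids *)

Record courant_str (R : realType) (n : nat) (M : manifold R n) (V : vbundle M) :=
  CourantStr {
  cmet : bmetric V;
  canc : anchor V;
  cbr : Γ V -> Γ V -> Γ V }.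

Section Courant.
Variables (R : realType) (n : nat) (M : manifold R n) (V : vbundle M).
Variable E : courant_str V.

Local Notation rho := (along (canc E)).
Local Notation "a ⋄ b" := (cbr E a b) (at level 38, right associativity).
Local Notation "⟨ a , b ⟩" := (mpair (cmet E) a b).

Definition cD (f : smoothfun M) : Γ V := riesz (cmet E) (fun s => rho s f).

Record is_courant : Prop := {
  cbrDl : forall a b c, (a + b) ⋄ c = a ⋄ c + b ⋄ c;
  cbrDr : forall a b c, a ⋄ (b + c) = a ⋄ b + a ⋄ c;
  cbrZl : forall r a b, (smooth_cst M r *: a) ⋄ b = smooth_cst M r *: (a ⋄ b);
  cbrZr : forall r a b, a ⋄ (smooth_cst M r *: b) = smooth_cst M r *: (a ⋄ b);
  cbr_jacobi : forall a b c, a ⋄ (b ⋄ c) = (a ⋄ b) ⋄ c + b ⋄ (a ⋄ c);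
  cbr_leibniz : forall a f b, a ⋄ (f *: b) = rho a f *: b + f *: (a ⋄ b);
  cbr_diag : forall a, a ⋄ a = half *: cD ⟨a, a⟩;
  cbr_metric : forall a b, rho a ⟨b, b⟩ = 2%:R * ⟨a ⋄ b, b⟩ }.

End Courant.

Section Isomorphism.
Variables (R : realType) (n : nat) (M : manifold R n) (V W : vbundle M).

Record bundle_map := BundleMap {
  bmap :> forall p, 'Hom(V p, W p);
  bmap_smooth : forall s : Γ V, smooth_section (fun p => bmap p (s p)) }.

Definition bmap_sect (u : bundle_map) (s : Γ V) : Γ W := Sect (bmap_smooth u s).

End Isomorphism.

Definition courant_iso (R : realType) (n : nat) (M : manifold R n)
    (V W : vbundle M) (E : courant_str V) (E' : courant_str W) : Prop :=
  exists (u : bundle_map V W) (u' : bundle_map W V),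
    [/\ (forall p x, u' p (u p x) = x) /\ (forall p y, u p (u' p y) = y),
        forall p x y, cmet E' p (u p x) (u p y) = cmet E p x y,
        forall p x f, canc E' p (u p x) f = canc E p x f
      & forall a b, bmap_sect u (cbr E a b) =
                    cbr E' (bmap_sect u a) (bmap_sect u b)].

(** * Connections and matched pairs *)

Record is_connection (R : realType) (n : nat) (M : manifold R n)
    (V W : vbundle M) (A : anchor V) (D : Γ V -> Γ W -> Γ W) : Prop := {
  connDl : forall a b w, D (a + b) w = D a w + D b w;
  connDr : forall a v w, D a (v + w) = D a v + D a w;
  connZr : forall r a w, D a (smooth_cst M r *: w) = smooth_cst M r *: D a w;
  conn_linear : forall f a w, D (f *: a) w = f *: D a w;
  conn_leibniz : forall a f w, D a (f *: w) = along A a f *: w + f *: D a w }.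

Definition preserves_metric (R : realType) (n : nat) (M : manifold R n)
    (V W : vbundle M) (A : anchor V) (m : bmetric W) (D : Γ V -> Γ W -> Γ W) :=
  forall a v w, along A a (mpair m v w) = mpair m (D a v) w + mpair m v (D a w).

Section Matched.
Variables (R : realType) (n : nat) (M : manifold R n).
Implicit Types V W : vbundle M.

(* With [Dl] the E2-connection on E1, this is Omega; exchanging the roles of
   the two algebroids gives mho. *)
Definition Omega V W (E1 : courant_str V) (E2 : courant_str W)
    (Dl : Γ W -> Γ V -> Γ V) (a b : Γ V) : Γ W :=
  riesz (cmet E2) (fun c =>
    half * (mpair (cmet E1) (Dl c a) b - mpair (cmet E1) a (Dl c b))).

(* Condition (1); condition (2) is obtained by exchanging the roles. *)
Definition mp_compat V W (E1 : courant_str V) (E2 : courant_str W)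
    (Dr : Γ V -> Γ W -> Γ W) (Dl : Γ W -> Γ V -> Γ V) : Prop :=
  forall (alpha : Γ W) (a1 a2 : Γ V),
    let w12 := Omega E1 E2 Dl a1 a2 + half *: cD E2 (mpair (cmet E1) a1 a2) in
    Dl alpha (cbr E1 a1 a2) - cbr E1 (Dl alpha a1) a2 - cbr E1 a1 (Dl alpha a2)
      - Dl (Dr a2 alpha) a1 + Dl (Dr a1 alpha) a2
    = - Omega E2 E1 Dr alpha w12 - half *: cD E1 (mpair (cmet E2) alpha w12).

Definition conn_curv V W (E : courant_str V) (D : Γ V -> Γ W -> Γ W)
    (a b : Γ V) (w : Γ W) : Γ W :=
  D a (D b w) - D b (D a w) - D (cbr E a b) w.

Record matched_pair V W (E1 : courant_str V) (E2 : courant_str W)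
    (Dr : Γ V -> Γ W -> Γ W) (Dl : Γ W -> Γ V -> Γ V) : Prop := {
  mp_courant1 : is_courant E1;
  mp_courant2 : is_courant E2;
  mp_conn1 : is_connection (canc E1) Dr;
  mp_conn2 : is_connection (canc E2) Dl;
  mp_metric1 : preserves_metric (canc E1) (cmet E2) Dr;
  mp_metric2 : preserves_metric (canc E2) (cmet E1) Dl;
  mp_exact1 : forall f beta, Dr (cD E1 f) beta = 0;
  mp_exact2 : forall f b, Dl (cD E2 f) b = 0;
  mp_compat1 : mp_compat E1 E2 Dr Dl;
  mp_compat2 : mp_compat E2 E1 Dl Dr;
  mp_curv : forall a1 a2 alpha1 alpha2,
    mpair (cmet E2) (conn_curv E1 Dr a1 a2 alpha1) alpha2 +
    mpair (cmet E1) (conn_curv E2 Dl alpha1 alpha2 a1) a2 = 0;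
  mp_cyclic1 : forall a1 a2 a3,
    Dl (Omega E1 E2 Dl a1 a2) a3 + Dl (Omega E1 E2 Dl a2 a3) a1
      + Dl (Omega E1 E2 Dl a3 a1) a2 = 0;
  mp_cyclic2 : forall alpha1 alpha2 alpha3,
    Dr (Omega E2 E1 Dr alpha1 alpha2) alpha3
      + Dr (Omega E2 E1 Dr alpha2 alpha3) alpha1
      + Dr (Omega E2 E1 Dr alpha3 alpha1) alpha2 = 0 }.

Definition matched_sum V W (E1 : courant_str V) (E2 : courant_str W)
    (Dr : Γ V -> Γ W -> Γ W) (Dl : Γ W -> Γ V -> Γ V) :
    courant_str (dsum V W) :=
  CourantStr (dsum_metric (cmet E1) (cmet E2))
    (dsum_anchor (canc E1) (canc E2))
    (fun u v =>
      let: (a, alpha) := (sfst u, ssnd u) in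
      let: (b, beta) := (sfst v, ssnd v) in
      spair (cbr E1 a b + Dl alpha b - Dl beta a + Omega E2 E1 Dr alpha beta
               + half *: cD E1 (mpair (cmet E2) alpha beta))
            (cbr E2 alpha beta + Dr a beta - Dr b alpha + Omega E1 E2 Dl a b
               + half *: cD E2 (mpair (cmet E1) a b))).

End Matched.

(** * Integrable subbundles and bundles of quadratic Lie algebras *)

(* An integrable subbundle of TM: a vector bundle with a fibrewise injective
   bundle map to TM whose sections are closed under the commutator. *)
Record foliation (R : realType) (n : nat) (M : manifold R n) := Foliation {
  fbun :> vbundle M;
  finc : anchor fbun;
  finc_inj : forall p (u v : fbun p), finc p u =1 finc p v -> u = v;
  finc_involutive : forall x y : Γ fbun, exists z : Γ fbun, forall f,
    along finc z f =
      along finc x (along finc y f) - along finc y (along finc x f) }.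

(* The commutator of vector fields tangent to F. *)
Definition fbr (R : realType) (n : nat) (M : manifold R n) (F : foliation M)
    (x y : Γ F) : Γ F :=
  xget 0 [set z | forall f, along (finc F) z f =
    along (finc F) x (along (finc F) y f)
      - along (finc F) y (along (finc F) x f)].

(* The fibrewise bracket varies smoothly; no local triviality as a bundle of
   Lie algebras is required. *)
Record qlie_bundle (R : realType) (n : nat) (M : manifold R n) := QLieBundle {
  qbun :> vbundle M;
  qmet : bmetric qbun;
  qbr : forall p, qbun p -> qbun p -> qbun p;
  qbr_linearl : forall p (v : qbun p), linear (fun u : qbun p => qbr u v);
  qbr_linearr : forall p (u : qbun p), linear (fun v : qbun p => qbr u v);
  qbr_alternating : forall p (u : qbun p), qbr u u = 0;
  qbr_jacobi : forall p (u v w : qbun p),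
    qbr u (qbr v w) + qbr v (qbr w u) + qbr w (qbr u v) = 0;
  qbr_invariant : forall p (u v w : qbun p),
    qmet p (qbr u v) w = qmet p u (qbr v w);
  qbr_smooth : forall r s : Γ qbun, smooth_section (fun p => qbr (r p) (s p)) }.

Definition gbr (R : realType) (n : nat) (M : manifold R n) (g : qlie_bundle M)
    (r s : Γ g) : Γ g := Sect (qbr_smooth r s).

Record curvature_map (R : realType) (n : nat) (M : manifold R n)
    (F V : vbundle M) := CurvatureMap {
  rmap :> forall p, F p -> F p -> V p;
  rmap_linearl : forall p (y : F p), linear (fun x : F p => rmap x y);
  rmap_linearr : forall p (x : F p), linear (fun y : F p => rmap x y);
  rmap_alternating : forall p (x : F p), rmap x x = 0;
  rmap_smooth : forall x y : Γ F, smooth_section (fun p => rmap (x p) (y p)) }.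

Definition rsect (R : realType) (n : nat) (M : manifold R n) (F V : vbundle M)
    (K : curvature_map F V) (x y : Γ F) : Γ V := Sect (rmap_smooth K x y).

Record form3 (R : realType) (n : nat) (M : manifold R n) (F : vbundle M) :=
  Form3 {
  hform :> forall p, F p -> F p -> F p -> R;
  hform_linear1 : forall p (y z : F p), scalar (fun x : F p => hform x y z);
  hform_linear2 : forall p (x z : F p), scalar (fun y : F p => hform x y z);
  hform_linear3 : forall p (x y : F p), scalar (fun z : F p => hform x y z);
  hform_alternating12 : forall p (x z : F p), hform x x z = 0;
  hform_alternating23 : forall p (x z : F p), hform x z z = 0;
  hform_smooth : forall x y z : Γ F, smooth (fun p => hform (x p) (y p) (z p)) }.

Definition hfun (R : realType) (n : nat) (M : manifold R n) (F : vbundle M)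
    (H : form3 F) (x y z : Γ F) : smoothfun M := SmoothFun (hform_smooth H x y z).

Section Leafwise.
Variables (R : realType) (n : nat) (M : manifold R n) (F : foliation M).
Local Notation L := (along (finc F)).

Definition d0 (f : smoothfun M) : Γ (dual F) := covec (fun y => L y f).

Definition lie (x : Γ F) (xi : Γ (dual F)) : Γ (dual F) :=
  covec (fun y => L x (eval xi y) - eval xi (fbr x y)).

(* iota_x (d_F xi) *)
Definition contr_d1 (x : Γ F) (xi : Γ (dual F)) : Γ (dual F) :=
  covec (fun y => L x (eval xi y) - L y (eval xi x) - eval xi (fbr x y)).

Definition contr_H (H : form3 F) (x y : Γ F) : Γ (dual F) :=
  covec (fun z => hfun H x y z).

(* d_F H, by the Koszul formula *)
Definition d3 (H : form3 F) (x y z t : Γ F) : smoothfun M :=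
  L x (hfun H y z t) - L y (hfun H x z t)
  + L z (hfun H x y t) - L t (hfun H x y z)
  - hfun H (fbr x y) z t + hfun H (fbr x z) y t - hfun H (fbr x t) y z
  - hfun H (fbr y z) x t + hfun H (fbr y t) x z - hfun H (fbr z t) x y.

(* (F (+) F^* )_H *)
Definition twisted (H : form3 F) : courant_str (dsum F (dual F)) :=
  CourantStr (hyper_metric F) (dsum_anchor (finc F) (zero_anchor (dual F)))
    (fun u v =>
      let: (x1, xi1) := (sfst u, ssnd u) in
      let: (x2, xi2) := (sfst v, ssnd v) in
      spair (fbr x1 x2) (lie x1 xi2 - contr_d1 x2 xi1 + contr_H H x1 x2)).

End Leafwise.

Definition qlie_courant (R : realType) (n : nat) (M : manifold R n)
    (g : qlie_bundle M) : courant_str g :=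
  CourantStr (qmet g) (zero_anchor g) (@gbr _ _ _ g).

(** * Standard Courant algebroids *)

Section Standard.
Variables (R : realType) (n : nat) (M : manifold R n).
Variables (F : foliation M) (g : qlie_bundle M).
Variables (D : Γ F -> Γ g -> Γ g) (K : curvature_map F g) (H : form3 F).

(* The 4-form <R, R>_g, evaluated on vectors of the fibre at p. *)
Definition curv_sq (p : M) (x : 'I_4 -> F p) : R :=
  4^-1 * \sum_(s : 'S_4) (-1) ^+ s *
    qmet g p (K p (x (s 0)) (x (s 1))) (K p (x (s 2%:R)) (x (s 3%:R))).

Definition flat : Prop := forall p (x : 'I_4 -> F p), curv_sq x = 0.

Record standard_data : Prop := {
  sd_conn : is_connection (finc F) D;
  sd_metric : preserves_metric (finc F) (qmet g) D;
  sd_bracket : forall x (r s : Γ g),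
    D x (gbr r s) = gbr (D x r) s + gbr r (D x s);
  sd_bianchi : forall x y z,
    (D x (rsect K y z) - rsect K (fbr x y) z)
    + (D y (rsect K z x) - rsect K (fbr y z) x)
    + (D z (rsect K x y) - rsect K (fbr z x) y) = 0;
  sd_curvature : forall x y r,
    D x (D y r) - D y (D x r) - D (fbr x y) r = gbr (rsect K x y) r;
  sd_dH : forall (x : 'I_4 -> Γ F) p,
    d3 H (x 0) (x 1) (x 2%:R) (x 3%:R) p = curv_sq (fun i => x i p) }.

Definition Pmap (r1 r2 : Γ g) : Γ (dual F) :=
  covec (fun y : Γ F => 2%:R * mpair (qmet g) r2 (D y r1)).

Definition Qmap (x : Γ F) (r : Γ g) : Γ (dual F) :=
  covec (fun y => mpair (qmet g) r (rsect K x y)).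

Definition std_bundle : vbundle M := dsum (dual F) (dsum g F).

Definition std_xi (xi : Γ (dual F)) : Γ std_bundle := spair xi 0.
Definition std_r (r : Γ g) : Γ std_bundle := spair 0 (spair r 0).
Definition std_x (x : Γ F) : Γ std_bundle := spair 0 (spair 0 x).

Record standard_courant (E : courant_str std_bundle) : Prop := {
  sc_courant : is_courant E;
  sc_anchor : forall p (u : std_bundle p) f, canc E p u f = finc F p u.2.2 f;
  sc_metric : forall p (u v : std_bundle p),
    cmet E p u v = 2^-1 * (u.1 v.2.2 : R) + 2^-1 * (v.1 u.2.2 : R)
                   + qmet g p u.2.1 v.2.1;
  sc_bracket : forall r1 r2,
    sfst (ssnd (cbr E (std_r r1) (std_r r2))) = gbr r1 r2 }.

Record has_data (E : courant_str std_bundle) : Prop := {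
  hd_data : standard_data;
  hd_xx : forall x1 x2, cbr E (std_x x1) (std_x x2) =
    std_xi (contr_H H x1 x2) + std_r (rsect K x1 x2) + std_x (fbr x1 x2);
  hd_rr : forall r1 r2, cbr E (std_r r1) (std_r r2) =
    std_xi (Pmap r1 r2) + std_r (gbr r1 r2);
  hd_xir : forall xi r, cbr E (std_xi xi) (std_r r) = 0;
  hd_rxi : forall r xi, cbr E (std_r r) (std_xi xi) = 0;
  hd_xixi : forall xi1 xi2, cbr E (std_xi xi1) (std_xi xi2) = 0;
  hd_xxi : forall x xi, cbr E (std_x x) (std_xi xi) = std_xi (lie x xi);
  hd_xix : forall xi x, cbr E (std_xi xi) (std_x x) =
    std_xi (- lie x xi + d0 F (eval xi x));
  hd_xr : forall x r, cbr E (std_x x) (std_r r) =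
    std_xi (- (2%:R *: Qmap x r)) + std_r (D x r);
  hd_rx : forall x r, cbr E (std_r r) (std_x x) =
    - cbr E (std_x x) (std_r r) }.

Definition conn_r (a : Γ (dsum F (dual F))) (r : Γ g) : Γ g := D (sfst a) r.

Definition conn_l (r : Γ g) (a : Γ (dsum F (dual F))) : Γ (dsum F (dual F)) :=
  spair 0 (2%:R *: Qmap (sfst a) r).

End Standard.

(* Main.v *)
From HB Require Import structures.
Require Import Defs.
From mathcomp Require Import all_boot all_order all_fingroup all_algebra.
From mathcomp Require Import all_classical all_reals all_analysis.
Import Order.TTheory GRing.Theory Num.Theory.
Import numFieldNormedType.Exports.
From mathcomp Require Import ring lra.
Set Implicit Arguments.
Unset Strict Implicit.
Unset Printing Implicit Defensive.
Local Open Scope classical_set_scope.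
Local Open Scope ring_scope.

(** Write a section of F (+) F^* as x + xi and a section of g as r.  The two
    connections see only the F-components: the first is D_x r, and the second
    is r |-> 2 Q(x, r), which has no F-component.  Hence the maps built from
    them can be computed in closed form: Omega(a, b) is the curvature R(x, y)
    of the F-components of a and b ([Omega_conn_l]), and mho(r, s) plus half of
    the exact term of <r, s> is the covector P(r, s) ([Omega_cD_conn_r]).  In
    other words, the correction terms of the matched sum are exactly the terms
    R, P and Q of the standard bracket, so regrouping F^* (+) g (+) F as
    (F (+) F^* ) (+) g is an isomorphism ([regroup_bracket]).

    With these formulas each matched pair condition turns into one of the
    structure equations of (D, R, H).  Compatibility (1) is the Bianchi
    identity for R; compatibility (2) says that D is a derivation of the
    bracket of g; the curvature condition says that the curvature of D is ad R,
    by the invariance of the metric of g; the cyclic condition on F (+) F^* is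
    the vanishing of the 4-form <R, R> ([flat_curv_cyclic]); the cyclic
    condition on g holds because mho takes its values in F^*.  Flatness is used
    a second time to see that d_F H = 0, which is what the twisted bracket on
    F (+) F^* needs in order to satisfy the Jacobi identity
    ([twisted_is_courant]).

    All of this compares sections by pairing them with arbitrary sections, and
    represents C^oo(M)-linear functionals by sections.  Both steps need enough
    global sections: one through each vector ([exists_sect]), and the fact that
    C^oo(M)-linearity implies pointwise dependence ([tensorial_local],
    [covecE]).  They rest on smooth bump functions, built from the classical
    flat function exp(-1/t). *)

Local Notation eval := Defs.eval.
Local Notation svalP := Defs.svalP.

(** * Flat functions *)

Section FlatFunctions.
Variable R : realType.
Implicit Types (m : nat) (t : R).

(** The factor t^-m makes the family stable under differentiation, up to
    linear combinations, so that smoothness needs only first derivatives. *)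
Definition flat_fun m t : R :=
  if 0 < t then t^-1 ^+ m * expR (- t^-1) else 0.

Lemma flat_fun_gt0 m t : 0 < t -> 0 < flat_fun m t.
Proof.
by move=> t0; rewrite /flat_fun t0 mulr_gt0 ?expR_gt0// exprn_gt0// invr_gt0.
Qed.

Lemma flat_fun_le0 m t : t <= 0 -> flat_fun m t = 0.
Proof. by move=> t0; rewrite /flat_fun ltNge t0. Qed.

(** A quadratic bound is enough for the derivative at 0 to vanish.  It comes
    from exp(y) >= (y / k)^k at y = 1/t and k = m + 2. *)
Lemma flat_fun_bound m t : `|flat_fun m t| <= m.+2%:R ^+ m.+2 * t ^+ 2.
Proof.
have [t0|t0] := leP t 0.
  by rewrite flat_fun_le0// normr0 mulr_ge0 ?sqr_ge0// exprn_ge0.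
rewrite gtr0_norm ?flat_fun_gt0// /flat_fun t0 expRN.
have y0 : 0 < t^-1 by rewrite invr_gt0.
set y := t^-1 in y0 *.
have k0 : 0 < m.+2%:R :> R by rewrite ltr0n.
have le_exp : (y / m.+2%:R) ^+ m.+2 <= expR y.
  have -> : expR y = expR (m.+2%:R * (y / m.+2%:R)).
    by congr expR; rewrite mulrC divfK ?gt_eqF.
  rewrite expRM_natl.
  apply: lerXn2r; rewrite ?nnegrE ?expR_ge0 ?divr_ge0 ?(ltW y0)//.
  by rewrite (le_trans _ (expR_ge1Dx _))// lerDr.
rewrite ler_pdivrMr ?expR_gt0//.
apply: le_trans (ler_wpM2l _ le_exp); last first.
  by rewrite mulr_ge0 ?sqr_ge0// exprn_ge0// ltW.
have c0 : m.+2%:R ^+ m.+2 != 0 :> R by rewrite expf_neq0// gt_eqF.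
rewrite expr_div_n; move: c0; set c := m.+2%:R ^+ m.+2 => c0.
suff -> : c * t ^+ 2 * (y ^+ m.+2 / c) = y ^+ m by [].
by rewrite [y ^+ m.+2]exprS [y ^+ m.+1]exprS /y; field; rewrite c0 gt_eqF.
Qed.

Lemma is_derive_flat_fun m t :
  is_derive t 1 (flat_fun m) (flat_fun m.+2 t - m%:R * flat_fun m.+1 t).
Proof.
have [t0|t0|t0] := ltgtP t 0.
- have -> : flat_fun m.+2 t - m%:R * flat_fun m.+1 t = 0.
    by rewrite !flat_fun_le0 ?mulr0 ?subrr// ltW.
  apply: (@near_eq_is_derive _ _ _ (cst (0 : R))).
  near=> u; rewrite flat_fun_le0//; apply/ltW.
  by near: u; exact: lt_nbhsl.
- pose h (u : R) := u^-1 ^+ m * expR (- u^-1).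
  apply: (@near_eq_is_derive _ _ _ h).
    near=> u; rewrite /h /flat_fun ifT//.
    by near: u; exact: lt_nbhsr.
  have dV : is_derive t 1 (fun u : R => u^-1) (- t ^- 2 *: 1).
    by apply: is_deriveV; rewrite gt_eqF.
  have dX := is_deriveX m dV.
  have dE : is_derive t 1 (expR \o (fun u => - u^-1))
      (expR (- t^-1) * (- (- t ^- 2 *: 1))).
    by apply: is_derive1_comp; exact: is_deriveN.
  have -> : h = (fun u => u^-1) ^+ m * (expR \o (fun u => - u^-1)).
    by apply/funext => u; rewrite /h [RHS]/GRing.mul/= exprfctE.
  apply: is_derive_eq.
  rewrite /flat_fun t0 /= exprfctE /GRing.scale /=.
  have t1 : t != 0 by rewrite gt_eqF.
  case: m {dX h} => [|k] /=; rewrite ?mul0r ?[t^-1 ^+ k.+3]exprS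
    ?[t^-1 ^+ k.+2]exprS ?[t^-1 ^+ k.+1]exprS; by field.

- subst t.
have -> : flat_fun m.+2 (0 : R) - m%:R * flat_fun m.+1 0 = 0.
  by rewrite !flat_fun_le0 ?mulr0 ?subrr.
pose C : R := m.+2%:R ^+ m.+2.
have C0 : 0 < C by rewrite exprn_gt0// ltr0n.
suff cv : (fun h : R =>
    h^-1 *: ((flat_fun m \o shift 0) (h *: 1) - flat_fun m 0)) @ 0^'
    --> (0 : R).
  by apply: DeriveDef; [apply/cvg_ex; exists 0|exact/cvg_lim].
apply/cvgr0Pnorm_le => e e0; near=> h.
rewrite /= addr0 [flat_fun m 0]flat_fun_le0// subr0 [h%:A]mulr1 normrZ.
have h0 : 0 < `|h| by rewrite normr_gt0; near: h; exact: nbhs_dnbhs_neq.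
rewrite normfV ler_pdivrMl//.
apply: le_trans (flat_fun_bound _ _) _.
rewrite -/C -real_normK ?num_real// mulrCA ler_pM2l// -ler_pdivlMl//.
by near: h; apply: dnbhs0_le; rewrite mulr_gt0// invr_gt0.
Unshelve. all: by end_near.
Qed.

(** By the chain rule, differentiating a composite only raises the index of the
    flat function and multiplies by a derivative of the inner function. *)
Lemma Ck_flat_comp n k m (U : set 'rV[R]_n) g : open U ->
  Cinf U g -> Ck k U (fun x => flat_fun m (g x)).
Proof.
move=> oU Cg; have [dg _] := Cg 1%N.
have df y m' : differentiable (flat_fun m' : R -> R) y.
  by apply/derivable1_diffP; have [] := is_derive_flat_fun m' y.
have dfg m' x : U x -> differentiable (fun x => flat_fun m' (g x)) x.
  by move=> Ux; apply: differentiable_comp; [exact: dg|exact: df].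
elim: k m => [|k IH] m /=.
  by move=> x Ux; apply: differentiable_continuous; exact: dfg.
split=> [x Ux|v]; first exact: dfg.
have Cc : Ck k U (fun x : 'rV[R]_n => - m%:R : R) by exact: Ck_cst.
have Ch := CkM oU (CkD oU (IH m.+2) (CkM oU Cc (IH m.+1))) ((Cg k.+1).2 v).
apply: (Ck_eq oU _ Ch) => x Ux.
rewrite [RHS]deriveE; last exact: dfg.
rewrite (@diff_comp _ _ _ _ g (flat_fun m) x (dg x Ux) (df _ _)) /=.
have -> : 'd (flat_fun m) (g x) ('d g x v) =
    'd g x v *: 'D_1 (flat_fun m) (g x).
  by rewrite -[X in 'd _ _ X = _]mulr1 linearZ /= (deriveE _ (df _ _)).
rewrite -deriveE//; last exact: dg.
by have [_ ->] := is_derive_flat_fun m (g x); rewrite [RHS]mulrC mulNr.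
Qed.

End FlatFunctions.

Lemma CkV (R : realType) n k (U : set 'rV[R]_n) (f : 'rV[R]_n -> R) : open U ->
  (forall x, U x -> f x != 0) -> Ck k U f -> Ck k U (fun x => (f x)^-1).
Proof.
move=> oU f0; elim: k => [|k IH] Cf.
  by move=> x Ux; apply: continuousV; [exact: f0|exact: Cf].
have [df Df] := Cf; split=> [x Ux|v].
  by apply: differentiableV; [exact: df|exact: f0].
have CV := IH (Ck_le Cf).
have Ch := CkM oU (CkM oU (@Ck_cst R n k U (-1)) (CkM oU CV CV)) (Df v).
apply: (Ck_eq oU _ Ch) => x Ux.
rewrite deriveV; [|exact: f0|exact/diff_derivable/df].
by rewrite mulN1r -invfM -expr2.
Qed.

(** * Bump functions on manifolds *)

Section Cutoffs.
Variables (R : realType) (n : nat) (M : manifold R n).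
Implicit Types (W : set M) (f : M -> R).

Lemma smooth_on_flat_comp m W f : open W ->
  smooth_on W f -> smooth_on W (fun p => flat_fun m (f p)).
Proof.
move=> oW sf c ac k.
by apply: (@Ck_flat_comp _ _ _ _ _ (f \o cinv c)) (sf c ac); exact: chart_open.
Qed.

Lemma smooth_onV W f : open W -> (forall p, W p -> f p != 0) ->
  smooth_on W f -> smooth_on W (fun p => (f p)^-1).
Proof.
move=> oW f0 sf c ac k.
apply: (@CkV _ _ _ _ (f \o cinv c)) (sf c ac k); first exact: chart_open.
by move=> _ [p [cp Wp] <-] /=; rewrite cmapK ?inE//; exact: f0.
Qed.

Lemma smooth_on_coord (c : chart R n M) j : atlas M c ->
  smooth_on (cdom c) (fun p => cmap c p 0 j).
Proof. by move=> ac c' ac'; exact: atlas_smooth. Qed.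

Lemma smooth_continuous f : smooth f -> continuous f.
Proof.
move=> sf p; have [c ac cp] := atlas_cover p.
have oc := cdom_open c.
have cimg : (cmap c @` (cdom c `&` setT)) (cmap c p) by exists p.
have fcont := sf c ac 0%N (cmap c p) cimg.
have mcont : {for p, continuous (cmap c)}.
  have := @cmap_continuous _ _ _ c; rewrite continuous_open_subspace//.
  by apply; rewrite inE.
have fE : f p = (f \o cinv c) (cmap c p) by rewrite /= cmapK ?inE.
rewrite /continuous_at fE.
apply: cvg_trans (continuous_comp mcont fcont).
apply: near_eq_cvg; near=> q; rewrite /= cmapK ?inE//.
by near: q; exact: open_nbhs_nbhs.
Unshelve. all: by end_near. Qed.

(** The last clause is the purpose of a cutoff: it extends by zero functions
    that are smooth on [W] only.  It holds because the support of [b] is a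
    closed subset of [W]; stating it directly avoids carrying that support. *)
Definition is_cutoff W (b : M -> R) :=
  [/\ smooth b, forall p, ~ W p -> b p = 0
    & forall W' f, open W' -> smooth_on (W `&` W') f ->
        smooth_on W' (fun p => b p * f p)].

(** In a chart at [p] take exp(-1/t) at t = r^2 - |x - x0|^2.  The support lies
    over a closed cube, hence is compact, hence closed in [M] by the Hausdorff
    property; this gives smoothness across the boundary of the chart domain. *)
Lemma exists_cutoff W p : open W -> W p ->
  exists2 b : M -> R, is_cutoff W b & b p != 0.
Proof.
move=> oW Wp; have [c ac cp] := atlas_cover p.
pose x0 := cmap c p.
have oI : open (cmap c @` (cdom c `&` W)) by exact: chart_open.
have /nbhs_ballP [r0 /= r00 ball_sub] :
    nbhs x0 (cmap c @` (cdom c `&` W)).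
  by apply: open_nbhs_nbhs; split=> //; exists p.
(* Half of the radius, so that the closed cube stays in the open ball. *)
pose r := r0 / 2.
have r_gt0 : 0 < r by rewrite divr_gt0.
pose B : set 'rV[R]_n :=
  [set x | forall j, `[x0 0 j - r, x0 0 j + r]%classic (x 0 j)].
have cB : compact B.
  apply: (@rV_compact _ _ (fun j => `[x0 0 j - r, x0 0 j + r]%classic)) => j.
  exact: segment_compact.
have BI : B `<=` cmap c @` (cdom c `&` W).
  move=> x Bx; apply: ball_sub; rewrite -ball_normE /=.
  rewrite (@le_lt_trans _ _ r)// ?ltr_pdivrMr ?mulr2n ?mulrDr ?mulr1 ?ltrDl//.
  rewrite [`|_|]mx_normrE; apply: bigmax_le => [|[i j] _]; first exact: ltW.
  have := Bx j; rewrite /= in_itv /= => Bxj.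
  by rewrite !mxE (ord1 i) ler_norml; lra.
pose K := cinv c @` B.
have cK : closed K.
  apply: compact_closed; first exact: manifold_hausdorff.
  apply: continuous_compact cB.
  apply: continuous_subspaceW (@cinv_continuous _ _ _ c).
  by move=> x /BI [q [cq _] <-]; exists q.
have KW : K `<=` cdom c `&` W.
  by move=> _ [x /BI [q cWq <-] <-]; rewrite cmapK ?inE//; case: cWq.
pose g q := r ^+ 2 - \sum_j (cmap c q 0 j - x0 0 j) ^+ 2.
pose b q : R := if `[< cdom c q >] then flat_fun 0 (g q) else 0.
have b0 q : ~ K q -> b q = 0.
  move=> Kq; rewrite /b; case: asboolP => // cq.
  apply: flat_fun_le0; rewrite leNgt; apply/negP => g0; apply: Kq.
  exists (cmap c q); last by rewrite cmapK ?inE.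
  move=> j /=; rewrite in_itv /=.
  have : (cmap c q 0 j - x0 0 j) ^+ 2 < r ^+ 2.
    move: g0; rewrite subr_gt0; apply: le_lt_trans.
    by rewrite (bigD1 j)//= lerDl sumr_ge0// => i _; exact: sqr_ge0.
  by nra.
have sb : smooth_on (cdom c) b.
  have oc := cdom_open c.
  apply: (@smooth_on_eq _ _ _ _ (fun q => flat_fun 0 (g q))) => //.
    by move=> q cq; rewrite /b asboolT.
  apply: smooth_on_flat_comp => //.
  apply: (@smooth_on_eq _ _ _ _
    (fun q => r ^+ 2 + \sum_(j < n)
       -1 * ((cmap c q 0 j - x0 0 j) * (cmap c q 0 j - x0 0 j)))) => //.
    move=> q _; rewrite /g -sumrN; congr (_ + _).
    by apply: eq_bigr => j _; rewrite mulN1r.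
  apply: smooth_onD => //; first exact: smooth_on_cst.
  apply: smooth_on_sum => // j.
  have sj : smooth_on (cdom c) (fun q => cmap c q 0 j - x0 0 j).
    by apply: smooth_onD => //; [exact: smooth_on_coord|exact: smooth_on_cst].
  apply: smooth_onM => //; first exact: smooth_on_cst.
  exact: smooth_onM.
have ext W' f : open W' -> smooth_on (W `&` W') f ->
    smooth_on W' (fun q => b q * f q).
  move=> oW' sf; apply: smooth_on_cover => q W'q.
  have [Kq|Kq] := pselect (K q).
    have oI' : open (cdom c `&` W `&` W').
      by do !apply: openI => //; exact: cdom_open.
    exists (cdom c `&` W `&` W'); split; first by split=> //; exact: KW.
    apply: smooth_onM => //.
      by apply: smooth_onS sb => u [[]].
    by apply: smooth_onS sf => u [[]].
  exists (~` K); split=> //.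
  apply: (@smooth_on_eq _ _ _ _ (fun=> 0)); first exact: closed_openC.
    by move=> u Ku; rewrite b0// mul0r.
  exact: smooth_on_cst.
exists b; last first.
  rewrite /b asboolT// gt_eqF// flat_fun_gt0// /g big1 ?subr0 ?exprn_gt0//.
  by move=> j _; rewrite subrr expr0n.
split=> //.
- have := ext setT (fun=> 1) openT (@smooth_on_cst _ _ _ _ 1).
  by apply: smooth_on_eq; [exact: openT|move=> q _; rewrite mulr1].
- by move=> q Wq; apply: b0 => /KW [].
Qed.

End Cutoffs.

(** * Sections and tensorial functionals *)

Section Tensoriality.
Variables (R : realType) (n : nat) (M : manifold R n) (V : vbundle M).
Implicit Types (s t : Γ V) (f : smoothfun M) (p : M).

Lemma sectN s p : (- s) p = - s p.
Proof. by rewrite /GRing.opp /= scaleN1r. Qed.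

Lemma sect_sum (I : Type) (r : seq I) (S : I -> Γ V) p :
  (\sum_(i <- r) S i) p = \sum_(i <- r) S i p.
Proof. by elim/big_rec2: _ => // i x y _ <-. Qed.

Lemma smoothfun_sum (I : Type) (r : seq I) (S : I -> smoothfun M) p :
  (\sum_(i <- r) S i) p = \sum_(i <- r) S i p.
Proof. by elim/big_rec2: _ => // i x y _ <-. Qed.

(** A local frame cut off by a bump function [b].  The expansion of a section
    holds globally after multiplication by the square of [b]: one factor cuts
    off the frame and the other one its coefficients. *)
Lemma local_frame (e : frame V) p : frames V e -> fdom e p ->
  exists (b : smoothfun M) (t : 'I_(frank e) -> Γ V)
    (h : Γ V -> 'I_(frank e) -> smoothfun M),
  [/\ b p != 0, forall q i, t i q = b q *: (fvec e q)`_i,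
      forall s q i, h s i q = b q * coord (fvec e q) i (s q)
    & forall s, (b * b) *: s = \sum_i h s i *: t i].
Proof.
move=> Ve ep; have oe := frame_open Ve.
have [b0 [sb b0_out b0_ext] b0p] := exists_cutoff oe ep.
pose b := SmoothFun sb.
have st (i : 'I_(frank e)) : smooth_section (V := V)
    (fun q => b q *: (fvec e q)`_i).
  move=> e' j Ve'; have oe' := frame_open Ve'.
  have := b0_ext _ _ oe' (frame_smooth i j Ve Ve').
  by apply: smooth_on_eq => // q _; rewrite linearZ.
have sh s (i : 'I_(frank e)) : smooth (fun q => b q * coord (fvec e q) i (s q)).
  apply: (b0_ext _ (fun q => coord (fvec e q) i (s q)) openT).
  by rewrite setIT; exact: svalP.
exists b, (fun i => Sect (st i)), (fun s i => SmoothFun (sh s i)).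
split=> // s; apply: sect_eq => q; rewrite sect_sum.
have [eq|eq] := pselect (fdom e q).
  rewrite [in LHS]/GRing.scale /=.
  rewrite [in LHS](coord_basis (frame_basis Ve eq) (memvf (s q))) scaler_sumr.
  apply: eq_bigr => i _.
  rewrite -[RHS]/((b q * _) *: (b q *: (fvec e q)`_i)) !scalerA; congr (_ *: _).
  by rewrite -[LHS]/(b q * b q * _) mulrAC.
have bq : b q = 0 := b0_out q eq.
rewrite big1.
  by rewrite -[LHS]/((b0 q * b q) *: s q) bq mulr0 scale0r.
by move=> i _; rewrite -[LHS]/((b q * _) *: (b q *: _)) bq scale0r scaler0.
Qed.

Lemma exists_sect p (v : V p) : exists s, s p = v.
Proof.
have [e Ve ep] := frame_cover V p.
have [b [t [_ [bp tE _ _]]]] := local_frame Ve ep.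
exists (\sum_i smooth_cst M (coord (fvec e p) i v / b p) *: t i).
rewrite sect_sum [RHS](coord_basis (frame_basis Ve ep) (memvf v)).
apply: eq_bigr => i _.
by rewrite -[LHS]/((_ / b p) *: t i p) tE scalerA divfK.
Qed.

Lemma eval_inj (xi eta : Γ (dual V)) :
  (forall y, eval xi y = eval eta y) -> xi = eta.
Proof.
move=> xe; apply: sect_eq => p; apply/lfunP => v.
have [s <-] := exists_sect v.
exact: (congr1 (fun f : smoothfun M => f p) (xe s)).
Qed.

Lemma mpair_inj (m : bmetric V) s t :
  (forall u, mpair m s u = mpair m t u) -> s = t.
Proof.
move=> st; apply: sect_eq => p; apply/eqP; rewrite -subr_eq0; apply/eqP.
apply: (@bform_nondegenerate _ _ _ _ m p) => v; have [u <-] := exists_sect v.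
have := congr1 (fun f : smoothfun M => f p) (st u) => /= stp.
by rewrite -scaleN1r addrC bform_linear mulN1r stp addNr.
Qed.

Lemma covec_eq (Phi : Γ V -> smoothfun M) xi :
  (forall y, eval xi y = Phi y) -> covec Phi = xi.
Proof.
move=> xiE; apply: eval_inj => y; rewrite xiE.
by rewrite /covec; case: xgetP => [eta _ ->|/(_ xi)//].
Qed.

Lemma riesz_eq (m : bmetric V) (Phi : Γ V -> smoothfun M) s :
  (forall t, mpair m s t = Phi t) -> riesz m Phi = s.
Proof.
move=> sE; apply: (@mpair_inj m) => t; rewrite sE.
by rewrite /riesz; case: xgetP => [u _ ->|/(_ s)//].
Qed.

Definition tensorial (Phi : Γ V -> smoothfun M) :=
  forall f s t, Phi (f *: s + t) = f * Phi s + Phi t.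

(** If s vanishes at p, then so do its cut-off coefficients in a local frame,
    hence also b^2 Phi(s), which is their combination with coefficients
    Phi(t_i). *)
Lemma tensorial_local Phi s t p :
  tensorial Phi -> s p = t p -> Phi s p = Phi t p.
Proof.
move=> tPhi.
have Phi0 : Phi 0 = 0.
  have := tPhi 1 0 0; rewrite scaler0 addr0 mul1r => /eqP.
  by rewrite eq_sym -[X in _ == X]addr0 (inj_eq (addrI _)) => /eqP.
have PhiZ f u : Phi (f *: u) = f * Phi u.
  by rewrite -[_ *: _]addr0 tPhi Phi0 addr0.
have PhiB u v : Phi (u - v) = Phi u - Phi v.
  by rewrite -scaleN1r addrC tPhi mulN1r addrC.
have Phi_sum I (r : seq I) (S : I -> Γ V) :
    Phi (\sum_(i <- r) S i) = \sum_(i <- r) Phi (S i).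
  elim/big_rec2: _ => // i x y _ <-.
  by rewrite -[S i]scale1r tPhi mul1r scale1r.
suff vanish (u : Γ V) : u p = 0 -> Phi u p = 0.
  move=> st; apply/eqP; rewrite -subr_eq0; apply/eqP.
  have := vanish (s - t); rewrite PhiB; apply.
  by rewrite -[LHS]/(s p + (- t) p) sectN st subrr.
move=> up.
have [e Ve ep] := frame_cover V p.
have [b [t' [h [bp _ hE sE]]]] := local_frame Ve ep.
have /(congr1 (fun f : smoothfun M => f p)) := congr1 Phi (sE u).
rewrite Phi_sum PhiZ smoothfun_sum big1 => [|i _]; last first.
  by rewrite PhiZ -[LHS]/(h u i p * _) hE up linear0 mulr0 mul0r.
rewrite -[LHS]/(b p * b p * Phi u p) => /eqP.
by rewrite !mulf_eq0 (negbTE bp) => /eqP.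
Qed.

(** By locality Phi defines a covector at each point.  Its frame coefficients
    are smooth because near a given point they equal Phi(t_i) / b, where t_i is
    the frame cut off by b. *)
Lemma covecE Phi y : tensorial Phi -> eval (covec Phi) y = Phi y.
Proof.
move=> tPhi.
pose ext p (v : V p) := projT1 (cid (exists_sect v)).
have extE p (v : V p) : ext p v p = v by rewrite /ext; case: cid.
pose phi p (v : V p) : R^o := Phi (ext p v) p.
have phi_lin p : linear (phi p).
  move=> a u v; rewrite /phi.
  rewrite (@tensorial_local _ _ (smooth_cst M a *: ext p u + ext p v))//.
    by rewrite tPhi.
  by rewrite extE -[RHS]/(a *: ext p u p + ext p v p) !extE.
pose L p := HB.pack_for {linear V p -> R^o} (phi p)
  (GRing.isLinear.Build _ _ _ _ (phi p) (phi_lin p)).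
pose xi0 p : dual V p := linfun (L p).
have xi0E s p : xi0 p (s p) = Phi s p.
  by rewrite lfunE /= /phi; apply: tensorial_local => //; rewrite extE.
have sxi0 : smooth_section xi0.
  move=> e' i [e Ve ee']; subst e'; apply: smooth_on_cover => p ep.
  have [b [t [_ [bp tE _ _]]]] := local_frame Ve ep.
  pose W := [set q | b q != 0].
  have oW : open W.
    have bc := smooth_continuous (@sfunP _ _ _ b).
    apply: (@open_comp _ _ b [set x | x != 0]); last exact: open_neq.
    by move=> q _; exact: bc.
  have oe := frame_open Ve.
  exists (W `&` fdom e); split; first by split.
  apply: (@smooth_on_eq _ _ _ _ (fun q => (b q)^-1 * Phi (t i) q)).
  - exact: openI.
  - move=> q [bq eq]; rewrite coord_dual; last exact: frame_basis.
    by rewrite -xi0E tE linearZ /= [X in _ * X]/GRing.scale /= mulKf.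
  - apply: smooth_onM; first exact: openI.
      apply: smooth_onV; [exact: openI|by move=> q []|].
      by apply: smooth_onS (@sfunP _ _ _ b).
    by apply: smooth_onS (@sfunP _ _ _ (Phi (t i))).
have xiE z : eval (Sect sxi0) z = Phi z.
  by apply: smoothfun_eq => p; exact: xi0E.
by rewrite (covec_eq xiE).
Qed.

End Tensoriality.

(** * Multilinear calculus of sections *)

Section Additive.
Variables (U W : zmodType) (f : U -> W).
Hypothesis fD : {morph f : u v / u + v}.

Lemma morph_add0 : f 0 = 0.
Proof. by apply: (addIr (f 0)); rewrite -fD !add0r. Qed.

Lemma morph_addN : {morph f : u / - u}.
Proof. by move=> u; apply: (addIr (f u)); rewrite -fD !addNr morph_add0. Qed.

End Additive.

Section Multilinear.
Variables (R : realType) (n : nat) (M : manifold R n).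
Implicit Types (V : vbundle M) (f h : smoothfun M).

Lemma alongDl V (A : anchor V) s t f :
  along A (s + t) f = along A s f + along A t f.
Proof.
apply: smoothfun_eq => p; rewrite -[LHS]/(A p (s p + t p) f).
by rewrite -[s p]scale1r anchor_linear mul1r ?scale1r.
Qed.

Lemma alongZl V (A : anchor V) h s f : along A (h *: s) f = h * along A s f.
Proof.
apply: smoothfun_eq => p; rewrite -[LHS]/(A p (h p *: s p) f).
rewrite -[h p *: s p]addr0 anchor_linear.
rewrite (_ : A p 0 f = 0) ?addr0//.
have := anchor_linear A (-1) (0 : V p) 0 f.
by rewrite scaler0 addr0 mulN1r addNr.
Qed.

Lemma alongNl V (A : anchor V) s f : along A (- s) f = - along A s f.
Proof. by apply: (morph_addN (f := along A ^~ f)) => u v; exact: alongDl. Qed.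

Lemma along0l V (A : anchor V) f : along A 0 f = 0.
Proof. by apply: (morph_add0 (f := along A ^~ f)) => u v; exact: alongDl. Qed.

Lemma alongDr V (A : anchor V) s f h :
  along A s (f + h) = along A s f + along A s h.
Proof. by apply: smoothfun_eq => p; exact: tderD. Qed.

Lemma alongNr V (A : anchor V) s f : along A s (- f) = - along A s f.
Proof. exact: (morph_addN (alongDr A s)). Qed.

Lemma along0r V (A : anchor V) s : along A s 0 = 0.
Proof. exact: (morph_add0 (alongDr A s)). Qed.

Lemma alongM V (A : anchor V) s f h :
  along A s (f * h) = along A s f * h + f * along A s h.
Proof. by apply: smoothfun_eq => p; exact: tderM. Qed.

Lemma along_cst V (A : anchor V) s c : along A s (smooth_cst M c) = 0.
Proof.
have along1 : along A s 1 = 0.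
  have := alongM A s 1 1; rewrite !mulr1 mul1r => /eqP.
  by rewrite -[X in X == _]addr0 (inj_eq (addrI _)) => /eqP.
rewrite -[smooth_cst M c]mulr1; apply: smoothfun_eq => p.
rewrite [LHS]tderZ.
by have := congr1 (fun f : smoothfun M => f p) along1 => /= ->; rewrite mulr0.
Qed.

Lemma alongZr V (A : anchor V) s c f :
  along A s (smooth_cst M c * f) = smooth_cst M c * along A s f.
Proof. by rewrite alongM along_cst mul0r add0r. Qed.

Definition alongE := (alongDl, alongNl, along0l, alongDr, alongNr, along0r).

Lemma zero_along V s f : along (zero_anchor V) s f = 0.
Proof. exact: smoothfun_eq. Qed.

Lemma dsum_along V W (A : anchor V) (B : anchor W) s f :
  along (dsum_anchor A B) s f = along A (sfst s) f + along B (ssnd s) f.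
Proof. exact: smoothfun_eq. Qed.

Lemma evalDl V (xi eta : Γ (dual V)) y :
  eval (xi + eta) y = eval xi y + eval eta y.
Proof. by apply: smoothfun_eq => p; rewrite /= add_lfunE. Qed.

Lemma evalZl V f (xi : Γ (dual V)) y : eval (f *: xi) y = f * eval xi y.
Proof. by apply: smoothfun_eq => p; rewrite /= scale_lfunE. Qed.

Lemma evalNl V (xi : Γ (dual V)) y : eval (- xi) y = - eval xi y.
Proof.
exact: (@morph_addN _ _ (fun xi => eval xi y) (fun u v => evalDl u v y)).
Qed.

Lemma eval0l V y : eval (0 : Γ (dual V)) y = 0.
Proof.
exact: (@morph_add0 _ _ (fun xi => eval xi y) (fun u v => evalDl u v y)).
Qed.

Lemma evalDr V (xi : Γ (dual V)) x y : eval xi (x + y) = eval xi x + eval xi y.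
Proof. by apply: smoothfun_eq => p; rewrite /= linearD. Qed.

Lemma evalZr V f (xi : Γ (dual V)) y : eval xi (f *: y) = f * eval xi y.
Proof. by apply: smoothfun_eq => p; rewrite /= linearZ. Qed.

Lemma evalNr V (xi : Γ (dual V)) y : eval xi (- y) = - eval xi y.
Proof. exact: (morph_addN (evalDr xi)). Qed.

Lemma eval0r V (xi : Γ (dual V)) : eval xi 0 = 0.
Proof. exact: (morph_add0 (evalDr xi)). Qed.

Definition evalE := (evalDl, evalNl, eval0l, evalDr, evalNr, eval0r,
  evalZl, evalZr).

Lemma mpairC V (m : bmetric V) s t : mpair m s t = mpair m t s.
Proof. by apply: smoothfun_eq => p; exact: bform_sym. Qed.

Lemma mpairZl V (m : bmetric V) f s t : mpair m (f *: s) t = f * mpair m s t.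
Proof.
apply: smoothfun_eq => p; rewrite -[LHS]/(m p (f p *: s p) (t p)).
by rewrite -[f p *: s p]addr0 bform_linear bform0l addr0.
Qed.

Lemma mpairDl V (m : bmetric V) s t u :
  mpair m (s + t) u = mpair m s u + mpair m t u.
Proof.
apply: smoothfun_eq => p; rewrite -[LHS]/(m p (s p + t p) (u p)).
by rewrite -[s p]scale1r bform_linear mul1r ?scale1r.
Qed.

Lemma mpairDr V (m : bmetric V) s t u :
  mpair m u (s + t) = mpair m u s + mpair m u t.
Proof. by rewrite mpairC mpairDl !(mpairC _ u). Qed.

Lemma mpairZr V (m : bmetric V) f s t : mpair m t (f *: s) = f * mpair m t s.
Proof. by rewrite mpairC mpairZl mpairC. Qed.

Lemma mpairNl V (m : bmetric V) s t : mpair m (- s) t = - mpair m s t.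
Proof. by apply: (morph_addN (f := mpair m ^~ t)) => u v; exact: mpairDl. Qed.

Lemma mpairNr V (m : bmetric V) s t : mpair m t (- s) = - mpair m t s.
Proof. by rewrite mpairC mpairNl mpairC. Qed.

Lemma mpair0l V (m : bmetric V) s : mpair m 0 s = 0.
Proof. by apply: (morph_add0 (f := mpair m ^~ s)) => u v; exact: mpairDl. Qed.

Lemma mpair0r V (m : bmetric V) s : mpair m s 0 = 0.
Proof. by rewrite mpairC mpair0l. Qed.

Definition mpairE := (mpairDl, mpairNl, mpair0l, mpairDr, mpairNr, mpair0r,
  mpairZl, mpairZr).

Lemma mulr2_half f : 2%:R * (Defs.half * f) = f.
Proof.
by apply: smoothfun_eq => p; rewrite -[LHS]/((1 + 1) * (2^-1 * f p)); field.
Qed.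

Lemma half_mulr2 f : Defs.half * (2%:R * f) = f.
Proof. by rewrite mulrCA mulr2_half. Qed.

Lemma half_double f : Defs.half * (f + f) = f.
Proof. by rewrite -[RHS]half_mulr2; congr (_ * _); ring. Qed.

Lemma hyper_mpair V (u v : Γ (dsum V (dual V))) :
  mpair (hyper_metric V) u v =
  Defs.half * (eval (ssnd u) (sfst v) + eval (ssnd v) (sfst u)).
Proof. by rewrite mulrDr; exact: smoothfun_eq. Qed.

Section Pairs.
Variables (V W : vbundle M).
Implicit Types (s : Γ V) (t : Γ W) (u v : Γ (dsum V W)).

Lemma sfst_pair s t : sfst (spair s t) = s. Proof. exact: sect_eq. Qed.
Lemma ssnd_pair s t : ssnd (spair s t) = t. Proof. exact: sect_eq. Qed.

Lemma spair_eta u : spair (sfst u) (ssnd u) = u.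
Proof. by apply: sect_eq => p /=; rewrite -surjective_pairing. Qed.

Lemma spair_eq u v : sfst u = sfst v -> ssnd u = ssnd v -> u = v.
Proof. by rewrite -{3}[u]spair_eta -{3}[v]spair_eta => -> ->. Qed.

Lemma sfstD u v : sfst (u + v) = sfst u + sfst v. Proof. exact: sect_eq. Qed.
Lemma ssndD u v : ssnd (u + v) = ssnd u + ssnd v. Proof. exact: sect_eq. Qed.
Lemma sfstZ f u : sfst (f *: u) = f *: sfst u. Proof. exact: sect_eq. Qed.
Lemma ssndZ f u : ssnd (f *: u) = f *: ssnd u. Proof. exact: sect_eq. Qed.
Lemma sfstN u : sfst (- u) = - sfst u. Proof. exact: (morph_addN sfstD). Qed.
Lemma ssndN u : ssnd (- u) = - ssnd u. Proof. exact: (morph_addN ssndD). Qed.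
Lemma sfst0 : sfst (0 : Γ (dsum V W)) = 0. Proof. exact: sect_eq. Qed.
Lemma ssnd0 : ssnd (0 : Γ (dsum V W)) = 0. Proof. exact: sect_eq. Qed.

End Pairs.

Definition pairE := (sfst_pair, ssnd_pair, sfstD, ssndD, sfstN, ssndN,
  sfst0, ssnd0, sfstZ, ssndZ).

Section Curvature.
Variables (F V : vbundle M) (K : curvature_map F V).

Lemma rsectDl x y z : rsect K (x + y) z = rsect K x z + rsect K y z.
Proof.
apply: sect_eq => p; rewrite -[LHS]/(K p (x p + y p) (z p)).
by rewrite -[x p]scale1r rmap_linearl ?scale1r.
Qed.

Lemma rsectxx x : rsect K x x = 0.
Proof. by apply: sect_eq => p; exact: rmap_alternating. Qed.

Lemma rsectZl f x y : rsect K (f *: x) y = f *: rsect K x y.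
Proof.
apply: sect_eq => p; rewrite -[LHS]/(K p (f p *: x p) (y p)).
rewrite -[f p *: x p]addr0 rmap_linearl (_ : K p 0 (y p) = 0) ?addr0//.
have := rmap_linearl K (y p) (-1) 0 0.
by rewrite scaler0 addr0 scaleN1r addNr.
Qed.

Lemma rsectDr x y z : rsect K z (x + y) = rsect K z x + rsect K z y.
Proof.
apply: sect_eq => p; rewrite -[LHS]/(K p (z p) (x p + y p)).
by rewrite -[x p]scale1r rmap_linearr ?scale1r.
Qed.

Lemma rsectC x y : rsect K x y = - rsect K y x.
Proof.
apply/eqP; rewrite -addr_eq0; apply/eqP.
have := rsectxx (x + y); rewrite rsectDl !rsectDr !rsectxx add0r addr0.
by [].
Qed.

Lemma rsectZr f x y : rsect K x (f *: y) = f *: rsect K x y.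
Proof. by rewrite rsectC rsectZl -scalerN -rsectC. Qed.

Lemma rsectNl x y : rsect K (- x) y = - rsect K x y.
Proof. by apply: (morph_addN (f := rsect K ^~ y)) => u v; exact: rsectDl. Qed.

Lemma rsectNr x y : rsect K y (- x) = - rsect K y x.
Proof. exact: (morph_addN (fun u v => rsectDr u v y)). Qed.

Lemma rsect0l x : rsect K 0 x = 0.
Proof. by apply: (morph_add0 (f := rsect K ^~ x)) => u v; exact: rsectDl. Qed.

Lemma rsect0r x : rsect K x 0 = 0.
Proof. exact: (morph_add0 (fun u v => rsectDr u v x)). Qed.

Definition rsectE := (rsectDl, rsectNl, rsect0l, rsectDr, rsectNr, rsect0r,
  rsectZl, rsectZr).

End Curvature.

Section ThreeForm.
Variables (F : vbundle M) (H : form3 F).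

Lemma hfunD3 x y u v : hfun H x y (u + v) = hfun H x y u + hfun H x y v.
Proof.
apply: smoothfun_eq => p; rewrite -[LHS]/(H p (x p) (y p) (u p + v p)).
by rewrite -[u p]scale1r hform_linear3 mul1r ?scale1r.
Qed.

Lemma hfunD2 x u v z : hfun H x (u + v) z = hfun H x u z + hfun H x v z.
Proof.
apply: smoothfun_eq => p; rewrite -[LHS]/(H p (x p) (u p + v p) (z p)).
by rewrite -[u p]scale1r hform_linear2 mul1r ?scale1r.
Qed.

Lemma hfunD1 u v y z : hfun H (u + v) y z = hfun H u y z + hfun H v y z.
Proof.
apply: smoothfun_eq => p; rewrite -[LHS]/(H p (u p + v p) (y p) (z p)).
by rewrite -[u p]scale1r hform_linear1 mul1r ?scale1r.
Qed.

Lemma hfun0l y z : hfun H 0 y z = 0.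
Proof.
by apply: (@morph_add0 _ _ (fun u => hfun H u y z)) => u v; exact: hfunD1.
Qed.

Lemma hfunxx x z : hfun H x x z = 0.
Proof. by apply: smoothfun_eq => p; exact: hform_alternating12. Qed.

Lemma hfunyy x z : hfun H x z z = 0.
Proof. by apply: smoothfun_eq => p; exact: hform_alternating23. Qed.

Lemma hfunC12 x y z : hfun H x y z = - hfun H y x z.
Proof.
apply/eqP; rewrite -addr_eq0; apply/eqP.
by have := hfunxx (x + y) z; rewrite hfunD1 !hfunD2 !hfunxx add0r addr0.
Qed.

Lemma hfunC23 x y z : hfun H x y z = - hfun H x z y.
Proof.
apply/eqP; rewrite -addr_eq0; apply/eqP.
by have := hfunyy x (y + z); rewrite hfunD3 !hfunD2 !hfunyy add0r addr0 addrC.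
Qed.

Lemma hfun0m x z : hfun H x 0 z = 0.
Proof. by rewrite hfunC12 hfun0l oppr0. Qed.

Lemma hfunZ3 f x y z : hfun H x y (f *: z) = f * hfun H x y z.
Proof.
apply: smoothfun_eq => p; rewrite -[LHS]/(H p (x p) (y p) (f p *: z p)).
rewrite -[f p *: z p]addr0 hform_linear3 (_ : H p (x p) (y p) 0 = 0) ?addr0//.
have := hform_linear3 H (x p) (y p) (-1) 0 0.
by rewrite scaler0 addr0 mulN1r addNr.
Qed.

Lemma hfunZ2 f x y z : hfun H x (f *: y) z = f * hfun H x y z.
Proof. by rewrite hfunC23 hfunZ3 -mulrN -hfunC23. Qed.

Lemma hfunZ1 f x y z : hfun H (f *: x) y z = f * hfun H x y z.
Proof. by rewrite hfunC12 hfunZ2 -mulrN -hfunC12. Qed.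

End ThreeForm.
End Multilinear.

(** * Leafwise Cartan calculus and the twisted bracket *)

Section LeafwiseCalculus.
Variables (R : realType) (n : nat) (M : manifold R n) (F : foliation M).
Local Notation L := (along (finc F)).
Implicit Types (x y z : Γ F) (xi eta : Γ (dual F)) (f : smoothfun M).

(** Identities between sections of F are checked on functions: the anchor of F
    is injective and tangent vectors are derivations. *)
Lemma along_inj x y : (forall f, L x f = L y f) -> x = y.
Proof.
move=> xy; apply: sect_eq => p; apply: finc_inj => f.
exact: (congr1 (fun f : smoothfun M => f p) (xy f)).
Qed.

Lemma along_fbr x y f : L (fbr x y) f = L x (L y f) - L y (L x f).
Proof.
rewrite /fbr; case: xgetP => [z _ ->//|nz].
by have [z zP] := finc_involutive x y; have := nz z zP.
Qed.

Lemma fbrC x y : fbr x y = - fbr y x.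
Proof. by apply: along_inj => f; rewrite alongNl !along_fbr opprB. Qed.

Lemma fbrDr x y z : fbr x (y + z) = fbr x y + fbr x z.
Proof. by apply: along_inj => f; rewrite !(along_fbr, alongE); ring. Qed.

Lemma fbrDl x y z : fbr (x + y) z = fbr x z + fbr y z.
Proof. by apply: along_inj => f; rewrite !(along_fbr, alongE); ring. Qed.

Lemma fbrxx x : fbr x x = 0.
Proof. by apply: along_inj => f; rewrite along_fbr alongE subrr. Qed.

Lemma fbr0r x : fbr x 0 = 0.
Proof. exact: (morph_add0 (fbrDr x)). Qed.

Lemma fbr0l x : fbr 0 x = 0.
Proof. by rewrite fbrC fbr0r oppr0. Qed.

Lemma fbrZr x f y : fbr x (f *: y) = L x f *: y + f *: fbr x y.
Proof.
apply: along_inj => h.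
by rewrite !(along_fbr, alongE, alongZl, alongM); ring.
Qed.

Lemma fbrZl x f y : fbr (f *: x) y = f *: fbr x y - L y f *: x.
Proof. by rewrite fbrC fbrZr opprD addrC -scalerN -fbrC. Qed.

Lemma fbr_jacobi x y z : fbr x (fbr y z) = fbr (fbr x y) z + fbr y (fbr x z).
Proof. by apply: along_inj => f; rewrite !(along_fbr, alongE); ring. Qed.

Lemma d0E f y : eval (d0 F f) y = L y f.
Proof. by apply: covecE => h s t; rewrite alongDl alongZl. Qed.

Lemma lieE x xi y : eval (lie x xi) y = L x (eval xi y) - eval xi (fbr x y).
Proof.
apply: covecE => f s t.
by rewrite fbrDr fbrZr !(evalE, alongE, alongM); ring.
Qed.

Lemma contr_d1E x xi y :
  eval (contr_d1 x xi) y =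
    L x (eval xi y) - L y (eval xi x) - eval xi (fbr x y).
Proof.
apply: covecE => f s t.
by rewrite fbrDr fbrZr !(evalE, alongE, alongM, alongZl); ring.
Qed.

Lemma contr_HE (H : form3 F) x y z : eval (contr_H H x y) z = hfun H x y z.
Proof. by apply: covecE => f s t; rewrite hfunD3 hfunZ3. Qed.

End LeafwiseCalculus.

Section Twisted.
Variables (R : realType) (n : nat) (M : manifold R n) (F : foliation M).
Variable H : form3 F.
Local Notation L := (along (finc F)).
Implicit Types (a b : Γ (dsum F (dual F))) (f : smoothfun M).

Lemma twisted_brE a b : cbr (twisted H) a b =
  spair (fbr (sfst a) (sfst b))
    (lie (sfst a) (ssnd b) - contr_d1 (sfst b) (ssnd a)
       + contr_H H (sfst a) (sfst b)).
Proof. by []. Qed.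

Lemma twisted_along a f : along (canc (twisted H)) a f = L (sfst a) f.
Proof. by rewrite dsum_along zero_along addr0. Qed.

(** The metric on F (+) F^* is half of the duality pairing, whence the
    factor 2. *)
Lemma twisted_cD f : cD (twisted H) f = spair 0 (2%:R *: d0 F f).
Proof.
apply: riesz_eq => s; rewrite twisted_along hyper_mpair !pairE !evalE d0E.
by rewrite addr0 half_mulr2.
Qed.

Definition cartanE := (lieE, contr_d1E, contr_HE, d0E).

(** Covector identities are evaluated on an arbitrary y.  After Cartan's
    formulas and the Jacobi identity for vector fields, the terms without H
    cancel; in the Jacobi identity of the bracket the terms with H add up to
    d_F H. *)
Lemma twisted_is_courant : (forall x y z t : Γ F, d3 H x y z t = 0) ->
  is_courant (twisted H).
Proof.
move=> dH0; split.
- move=> a b c; apply: spair_eq; rewrite !twisted_brE !pairE ?fbrDl//.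
  apply: eval_inj => y.
  by rewrite !(evalE, cartanE) !(fbrDl, hfunD1, evalE, alongE); ring.
- move=> a b c; apply: spair_eq; rewrite !twisted_brE !pairE ?fbrDr//.
  apply: eval_inj => y.
  by rewrite !(evalE, cartanE) !(fbrDl, hfunD2, evalE, alongE); ring.
- move=> r a b; apply: spair_eq; rewrite !twisted_brE !pairE.
    by rewrite fbrZl along_cst scale0r subr0.
  apply: eval_inj => y.
  rewrite !(evalE, cartanE) fbrZl along_cst scale0r subr0.
  by rewrite !(hfunZ1, evalE, alongZl, alongZr); ring.
- move=> r a b; apply: spair_eq; rewrite !twisted_brE !pairE.
    by rewrite fbrZr along_cst scale0r add0r.
  apply: eval_inj => y.
  rewrite !(evalE, cartanE) fbrZl along_cst scale0r subr0.
  by rewrite !(hfunZ2, evalE, alongZl, alongZr); ring.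
- move=> a b c; apply: spair_eq; rewrite !twisted_brE !pairE.
    exact: fbr_jacobi.
  apply: eval_inj => y.
  have := dH0 (sfst a) (sfst b) (sfst c) y; rewrite /d3.
  move: (sfst a) (sfst b) (sfst c) => x1 x2 x3.
  move: (ssnd a) (ssnd b) (ssnd c) => xi1 xi2 xi3.
  rewrite !(evalE, cartanE) !(alongE, evalE, along_fbr).
  (* A normal form for iterated brackets, then for the arguments of H. *)
  rewrite (fbr_jacobi x1 x2 y) (fbr_jacobi x1 x3 y) (fbr_jacobi x2 x3 y).
  rewrite !evalDr.
  have rot x z t : hfun H z t x = hfun H x z t by rewrite hfunC23 hfunC12 opprK.
  rewrite !(rot (fbr _ y)) !(hfunC12 _ _ (fbr _ _) y) => dH.
  by apply/eqP; rewrite -subr_eq0 -dH; apply/eqP; ring.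
- move=> a f b; apply: spair_eq; rewrite !twisted_brE !pairE twisted_along.
    exact: fbrZr.
  apply: eval_inj => y.
  rewrite !(evalE, cartanE) fbrZl !(hfunZ2, evalE, alongZl, alongM, alongE).
  by ring.
- move=> a; rewrite twisted_cD hyper_mpair; apply: spair_eq; rewrite !pairE.
    by rewrite fbrxx scaler0.
  apply: eval_inj => y.
  rewrite !(evalE, cartanE) hfunxx alongZr !alongDr half_mulr2 half_double.
  by ring.
- move=> a b; rewrite twisted_along !hyper_mpair twisted_brE !pairE.
  rewrite alongZr mulr2_half !(evalE, cartanE) alongE hfunyy fbrxx eval0r.
  rewrite half_double.
  by ring.
Qed.
End Twisted.

(** * Flatness *)

(** A permutation of n + 1 letters is the choice of the image of the first one
    and a permutation of the others; bijectivity follows from the count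
    (n + 1)! = (n + 1) n!. *)
Lemma sum_perm_recl (A : zmodType) n (G : 'S_n.+1 -> A) :
  \sum_s G s = \sum_(j < n.+1) \sum_(s : 'S_n) G (lift_perm ord0 j s).
Proof.
pose lp (js : 'I_n.+1 * 'S_n) := lift_perm ord0 js.1 js.2.
have lp_inj : injective lp.
  move=> [i s] [j t]; rewrite /lp /= => st.
  have ij : i = j by rewrite -(lift_perm_id ord0 i s) st lift_perm_id.
  subst j; congr pair; apply/permP => k; apply: (@lift_inj _ i).
  by rewrite -!(lift_perm_lift ord0) st.
rewrite pair_big /= (reindex lp) //=; apply: onW_bij.
apply: inj_card_bij lp_inj _.
by rewrite card_prod card_ord !card_Sn factS.
Qed.

(** The indices are natural numbers in [w] so that, once the three sums are
    expanded, all 24 terms reduce to explicit ones by computation. *)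
Lemma sum_sign_perm4 (A : comPzRingType) (w : nat -> nat -> nat -> nat -> A) :
  \sum_(s : 'S_4) (-1) ^+ s * w (s 0) (s 1) (s 2%:R) (s 3%:R) =
  \sum_(i < 4) \sum_(j < 3) \sum_(k < 2) (-1) ^+ (i + j + k) *
    w i (bump i j) (bump i (bump j k)) (bump i (bump j (bump k 0))).
Proof.
have o1 : (1 : 'I_4) = lift ord0 ord0 by exact: val_inj.
have o2 : (2%:R : 'I_4) = lift ord0 (lift ord0 ord0) by exact: val_inj.
have o3 : (3%:R : 'I_4) = lift ord0 (lift ord0 (lift ord0 ord0)).
  exact: val_inj.
rewrite o3 o2 o1 sum_perm_recl; apply: eq_bigr => i _.
rewrite sum_perm_recl; apply: eq_bigr => j _.
rewrite sum_perm_recl; apply: eq_bigr => k _.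
rewrite sum_perm_recl big_ord_recl big_ord0 addr0.
rewrite (big_pred1 1%g) => [|s]; last first.
  by apply/esym/eqP/permP => -[].
rewrite !(lift_perm_lift, lift_perm_id); congr (_ * _).
rewrite !odd_lift_perm odd_perm1 /= !addbF -[RHS]signr_odd !oddD.
by rewrite addbA.
Qed.

Section Flat.
Variables (R : realType) (n : nat) (M : manifold R n).
Variables (F : foliation M) (g : qlie_bundle M) (K : curvature_map F g).

(** The 24 terms of <R, R>(x, y, z, t) fall into three groups of eight equal
    ones, by skewness of R and symmetry of the metric. *)
Lemma flat_curv_cyclic (x y z t : Γ F) : Defs.flat K ->
  mpair (qmet g) (rsect K x y) (rsect K z t)
  + mpair (qmet g) (rsect K y z) (rsect K x t)
  + mpair (qmet g) (rsect K z x) (rsect K y t) = 0.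
Proof.
move=> fK; apply: smoothfun_eq => p.
change (qmet g p (K p (x p) (y p)) (K p (z p) (t p))
  + qmet g p (K p (y p) (z p)) (K p (x p) (t p))
  + qmet g p (K p (z p) (x p)) (K p (y p) (t p)) = 0).
pose X k := nth 0 [:: x p; y p; z p; t p] k.
have := fK p (fun i => X (val i)).
rewrite /curv_sq (sum_sign_perm4
  (fun i j k l => qmet g p (K p (X i) (X j)) (K p (X k) (X l)))).
rewrite !big_ord_recl !big_ord0 /= /X /=.
have KC u v : K p u v = - K p v u.
  apply/eqP; rewrite -addr_eq0; apply/eqP.
  have KDl (a b c : F p) : K p (a + b) c = K p a c + K p b c.
    by rewrite -{1}[a]scale1r rmap_linearl scale1r.
  have KDr (a b c : F p) : K p c (a + b) = K p c a + K p c b.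
    by rewrite -{1}[a]scale1r rmap_linearr scale1r.
  have := rmap_alternating K (u + v).
  by rewrite KDl !KDr !rmap_alternating add0r addr0.
have qC : forall u v : g p, qmet g p u v = qmet g p v u by exact: bform_sym.
have qNl (u v : g p) : qmet g p (- u) v = - qmet g p u v.
  by rewrite -[- u]addr0 -scaleN1r bform_linear bform0l addr0 mulN1r.
have qNr (u v : g p) : qmet g p u (- v) = - qmet g p u v by rewrite qC qNl qC.
rewrite !(KC (y p) (x p)) !(KC (z p) (x p)) !(KC (t p) (x p)) !(KC (z p) (y p)).
rewrite !(KC (t p) (y p)) !(KC (t p) (z p)) !(qNl, qNr).
rewrite !(qC (K p (z p) (t p)) (K p (x p) (y p))).
rewrite !(qC (K p (y p) (t p)) (K p (x p) (z p))).
rewrite !(qC (K p (y p) (z p)) (K p (x p) (t p))).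
have sgnE k : (-1) ^+ k = if odd k then -1 else 1 :> R.
  by rewrite -signr_odd; case: odd; rewrite ?expr1 ?expr0.
rewrite !sgnE /= => E.
by lra.
Qed.
End Flat.

(** * The matched pair *)

Section QuadraticLie.
Variables (R : realType) (n : nat) (M : manifold R n) (g : qlie_bundle M).
Implicit Types (r s t : Γ g) (f : smoothfun M).
Local Notation "⟪ r , s ⟫" := (mpair (qmet g) r s) (at level 0).

Lemma gbrDl r s t : gbr (r + s) t = gbr r t + gbr s t.
Proof.
apply: sect_eq => p; rewrite -[LHS]/(qbr (r p + s p) (t p)).
by rewrite -[r p]scale1r qbr_linearl ?scale1r.
Qed.

Lemma gbrDr r s t : gbr t (r + s) = gbr t r + gbr t s.
Proof.
apply: sect_eq => p; rewrite -[LHS]/(qbr (t p) (r p + s p)).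
by rewrite -[r p]scale1r qbr_linearr ?scale1r.
Qed.

Lemma gbrrr r : gbr r r = 0.
Proof. by apply: sect_eq => p; exact: qbr_alternating. Qed.

Lemma gbrC r s : gbr r s = - gbr s r.
Proof.
apply/eqP; rewrite -addr_eq0; apply/eqP.
by have := gbrrr (r + s); rewrite gbrDl !gbrDr !gbrrr add0r addr0.
Qed.

Lemma gbrNr r s : gbr r (- s) = - gbr r s.
Proof. exact: (morph_addN (fun u v => gbrDr u v r)). Qed.

Lemma gbrZr f r s : gbr r (f *: s) = f *: gbr r s.
Proof.
apply: sect_eq => p; rewrite -[LHS]/(qbr (r p) (f p *: s p)).
rewrite -[f p *: s p]addr0 qbr_linearr (_ : qbr (r p) 0 = 0) ?addr0//.
have := qbr_linearr (r p) (-1) 0 0.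
by rewrite scaler0 addr0 scaleN1r addNr.
Qed.

Lemma gbrZl f r s : gbr (f *: r) s = f *: gbr r s.
Proof. by rewrite gbrC gbrZr -scalerN -gbrC. Qed.

Lemma gbr_jacobi r s t : gbr r (gbr s t) = gbr (gbr r s) t + gbr s (gbr r t).
Proof.
have jac : gbr r (gbr s t) + gbr s (gbr t r) + gbr t (gbr r s) = 0.
  by apply: sect_eq => p; exact: qbr_jacobi.
rewrite (gbrC (gbr r s)) (gbrC r t) gbrNr.
by apply/eqP; rewrite -subr_eq0 -jac opprD !opprK addrA addrAC.
Qed.

Lemma gbr_invariant r s t : ⟪gbr r s, t⟫ = ⟪r, gbr s t⟫.
Proof. by apply: smoothfun_eq => p; exact: qbr_invariant. Qed.

Lemma qlie_along r f : along (canc (qlie_courant g)) r f = 0.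
Proof. exact: zero_along. Qed.

Lemma qlie_cD f : cD (qlie_courant g) f = 0.
Proof. by apply: riesz_eq => s; rewrite qlie_along mpair0l. Qed.

Lemma qlie_is_courant : is_courant (qlie_courant g).
Proof.
split=> [r s t|r s t|c r s|c r s|r s t|r f s|r|r s] /=.
- exact: gbrDl.
- exact: gbrDr.
- exact: gbrZl.
- exact: gbrZr.
- exact: gbr_jacobi.
- by rewrite zero_along scale0r add0r gbrZr.
- by rewrite gbrrr qlie_cD scaler0.
- by rewrite zero_along gbr_invariant gbrrr mpair0r mulr0.
Qed.

End QuadraticLie.

Section MatchedPair.
Variables (R : realType) (n : nat) (M : manifold R n).
Variables (F : foliation M) (g : qlie_bundle M).
Variables (D : Γ F -> Γ g -> Γ g) (K : curvature_map F g) (H : form3 F).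
Hypotheses (dataP : standard_data D K H).
Local Notation L := (along (finc F)).
Local Notation "⟪ r , s ⟫" := (mpair (qmet g) r s) (at level 0).
Local Notation E1 := (twisted H).
Local Notation E2 := (qlie_courant g).
Implicit Types (x y z : Γ F) (r s t : Γ g) (f : smoothfun M).
Implicit Types (a b c : Γ (dsum F (dual F))).

Let connP := sd_conn dataP.
Let D_metric := sd_metric dataP.

Lemma conn0l r : D 0 r = 0.
Proof.
by apply: (morph_add0 (f := D ^~ r)) => u v; exact: connDl connP _ _ _.
Qed.

Lemma connNr x r : D x (- r) = - D x r.
Proof. exact: (morph_addN (connDr connP x)). Qed.

Lemma PmapE r s y : eval (Pmap D r s) y = 2%:R * ⟪s, D y r⟫.
Proof.
apply: covecE => f x z.
by rewrite (connDl connP) (conn_linear connP) !mpairE; ring.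
Qed.

Lemma QmapE x r y : eval (Qmap K x r) y = ⟪r, rsect K x y⟫.
Proof. by apply: covecE => f s t; rewrite !(rsectE, mpairE). Qed.

Lemma conn_lE r a : conn_l K r a = spair 0 (2%:R *: Qmap K (sfst a) r).
Proof. by []. Qed.

(** The structure equation d_F H = <R, R> with vanishing right-hand side. *)
Lemma flat_d3 : Defs.flat K -> forall x y z t : Γ F, d3 H x y z t = 0.
Proof.
move=> fK x y z t; apply: smoothfun_eq => p.
have := sd_dH dataP (fun i : 'I_4 => nth 0 [:: x; y; z; t] i) p.
by rewrite fK.
Qed.

(** Half the metric of F (+) F^* cancels the factor 2 of the connection, and the
    two skew terms <r, R(x, y)> and - <r, R(y, x)> are equal. *)
Lemma Omega_conn_l a b :
  Omega E1 E2 (conn_l K) a b = rsect K (sfst a) (sfst b).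
Proof.
apply: riesz_eq => r; rewrite !hyper_mpair !pairE !evalE !QmapE.
rewrite (rsectC K (sfst b)) mpairNr addr0 add0r mpairC.
by rewrite !half_mulr2 opprK half_double.
Qed.

Lemma Omega_conn_r r s : Omega E2 E1 (conn_r D) r s =
  spair 0 (Defs.half *: (Pmap D r s - Pmap D s r)).
Proof.
apply: riesz_eq => a; rewrite hyper_mpair !pairE !evalE !PmapE addr0 /conn_r /=.
by rewrite (mpairC _ r) -mulrBr half_mulr2 mpairC.
Qed.

(** The first summand is <D_y r, s> - <r, D_y s> and the second one is
    L_y <r, s>; as D preserves the metric, they add up to 2 <D_y r, s>. *)
Lemma Omega_cD_conn_r r s :
  Omega E2 E1 (conn_r D) r s + Defs.half *: cD E1 ⟪r, s⟫ = spair 0 (Pmap D r s).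
Proof.
rewrite Omega_conn_r twisted_cD; apply: spair_eq; rewrite !pairE.
  by rewrite scaler0 addr0.
apply: eval_inj => y; rewrite !(evalE, PmapE, d0E) half_mulr2 D_metric.
rewrite -mulrBr half_mulr2 (mpairC _ r) (mpairC _ (D y r) s).
by ring.
Qed.

Lemma conn_l_skew r a b :
  mpair (hyper_metric F) (conn_l K r a) b = ⟪r, rsect K (sfst a) (sfst b)⟫.
Proof.
by rewrite hyper_mpair !pairE !evalE QmapE addr0 half_mulr2.
Qed.

(** Evaluated on y, the difference of the two sides is -2 times the pairing of r
    with the Bianchi identity for (x1, x2, y). *)
Lemma mp_compat_twisted : mp_compat E1 E2 (conn_r D) (conn_l K).
Proof.
move=> r a1 a2 w; rewrite /w qlie_cD scaler0 addr0 Omega_conn_l {w}.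
rewrite -opprD Omega_cD_conn_r !conn_lE !twisted_brE /conn_r !pairE.
move: (sfst a1) (sfst a2) => x1 x2.
apply: spair_eq; rewrite !pairE.
  by rewrite fbr0l fbr0r !subr0 addr0 oppr0.
apply: eval_inj => y.
rewrite !(evalE, cartanE, alongE, QmapE, PmapE) fbr0l hfun0l hfun0m.
have := congr1 (mpair (qmet g) r) (sd_bianchi dataP x1 x2 y).
rewrite (rsectC K y x1) connNr (rsectC K (fbr x2 y)) (fbrC y x1) rsectNl.
rewrite (rsectC K (fbr x1 y)) !mpairE => bianchi.
rewrite !mulr_natl !mulr2n !alongDr !D_metric (mpairC _ (rsect K x1 x2)) !evalE.
apply/eqP; rewrite -subr_eq0; apply/eqP.
by apply: etrans (mulr0 (- 2%:R)); rewrite -[in RHS]bianchi; ring.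
Qed.

(** All terms but those of the derivation property of D vanish, since the other
    connection produces sections without F-component. *)
Lemma mp_compat_qlie : mp_compat E2 E1 (conn_l K) (conn_r D).
Proof.
move=> a r s w; rewrite /w Omega_cD_conn_r {w} qlie_cD scaler0 subr0.
rewrite Omega_conn_l !conn_lE /conn_r !pairE rsect0r !conn0l oppr0 !addr0.
by rewrite /= (sd_bracket dataP) [X in X - _]addrAC addrK subrr.
Qed.

Lemma conn_r_is_connection : is_connection (canc E1) (conn_r D).
Proof.
split=> [a b r|a r s|c a r|f a r|a f r].
- by rewrite /conn_r !pairE; exact: (connDl connP).
- exact: (connDr connP).
- exact: (connZr connP).
- by rewrite /conn_r !pairE; exact: (conn_linear connP).
- by rewrite twisted_along; exact: (conn_leibniz connP).
Qed.

Lemma conn_l_is_connection : is_connection (canc E2) (conn_l K).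
Proof.
split=> [r s a|r a b|c r a|f r a|r f a]; rewrite ?qlie_along ?scale0r ?add0r;
  apply: spair_eq; rewrite !pairE ?addr0 ?scaler0//; apply: eval_inj => y;
  by rewrite !(evalE, QmapE, rsectE, mpairE); ring.
Qed.

(** In the curvature condition the products of two operators [conn_l] vanish,
    since these read the F-component and produce none. *)
Lemma matched_twisted_qlie : Defs.flat K ->
  matched_pair E1 E2 (conn_r D) (conn_l K).
Proof.
move=> fK; split.
- exact/twisted_is_courant/flat_d3.
- exact: qlie_is_courant.
- exact: conn_r_is_connection.
- exact: conn_l_is_connection.
- by move=> a r s; rewrite twisted_along; exact: D_metric.
- move=> r a b; rewrite qlie_along (mpairC _ a) !conn_l_skew.
  by rewrite (rsectC K (sfst b)) mpairNr subrr.
- by move=> f r; rewrite /conn_r twisted_cD !pairE conn0l.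
- move=> f a; rewrite qlie_cD.
  apply: (@morph_add0 _ _ (fun r => conn_l K r a)) => r s.
  exact: (connDl conn_l_is_connection).
- exact: mp_compat_twisted.
- exact: mp_compat_qlie.
- move=> a1 a2 r s.
  rewrite /conn_curv /conn_r twisted_brE pairE (sd_curvature dataP).
  have conn_l_nilp t u a : conn_l K t (conn_l K u a) = 0.
    rewrite !conn_lE; apply: spair_eq; rewrite !pairE//.
    by apply: eval_inj => y; rewrite !(evalE, QmapE) rsect0l mpair0r mulr0.
  rewrite !conn_l_nilp subrr sub0r mpairNl conn_l_skew gbr_invariant mpairC.
  by rewrite subrr.
- move=> a1 a2 a3; rewrite !Omega_conn_l !conn_lE.
  apply: spair_eq; rewrite !pairE ?addr0//; apply: eval_inj => y.
  rewrite !(evalE, QmapE).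
  by rewrite -!mulrDr flat_curv_cyclic// mulr0.
- by move=> r s t; rewrite /conn_r !Omega_conn_r !pairE !conn0l !addr0.
Qed.

End MatchedPair.

(** * The matched sum *)

Lemma exists_bundle_map (R : realType) (n : nat) (M : manifold R n)
    (V W : vbundle M) (phi : forall p, V p -> W p) :
  (forall p, linear (phi p)) ->
  (forall s : Γ V, exists t : Γ W, forall p, t p = phi p (s p)) ->
  exists u : bundle_map V W, forall p v, u p v = phi p v.
Proof.
move=> phi_lin phi_smooth.
pose L p := HB.pack_for {linear V p -> W p} (phi p)
  (GRing.isLinear.Build _ _ _ _ (phi p) (phi_lin p)).
have LE p v : linfun (L p) v = phi p v by rewrite lfunE.
have sL (s : Γ V) : smooth_section (fun p => linfun (L p) (s p)).
  have [t tE] := phi_smooth s.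
  move=> e i We; apply: smooth_on_eq (svalP t i We); first exact: frame_open.
  by move=> p _; rewrite tE LE.
by exists (@BundleMap _ _ _ _ _ (fun p => linfun (L p)) sL).
Qed.

Section Regrouping.
Variables (R : realType) (n : nat) (M : manifold R n).
Variables (F : foliation M) (g : qlie_bundle M).
Variables (E : courant_str (std_bundle F g)).
Variables (D : Γ F -> Γ g -> Γ g) (K : curvature_map F g) (H : form3 F).
Hypotheses (stdE : standard_courant E) (dataE : has_data D K H E).

Definition regroup (s : Γ (std_bundle F g)) : Γ (dsum (dsum F (dual F)) g) :=
  spair (spair (ssnd (ssnd s)) (sfst s)) (sfst (ssnd s)).

Lemma std_decomposition (s : Γ (std_bundle F g)) :
  s = std_xi g (sfst s) + std_r F (sfst (ssnd s)) + std_x g (ssnd (ssnd s)).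
Proof.
apply: spair_eq; rewrite !pairE ?addr0//.
by apply: spair_eq; rewrite !pairE !(addr0, add0r).
Qed.

Lemma contr_d1_lie x (xi : Γ (dual F)) :
  contr_d1 x xi = lie x xi - d0 F (eval xi x).
Proof. by apply: eval_inj => y; rewrite !(evalE, cartanE); ring. Qed.

(** Both sides are biadditive, so it suffices to compare the brackets of the
    three kinds of sections; the correction terms of the matched sum are those
    of the standard bracket by the formulas for Omega and mho. *)
Lemma regroup_bracket a b : regroup (cbr E a b) =
  cbr (matched_sum (twisted H) (qlie_courant g) (conn_r D) (conn_l K))
    (regroup a) (regroup b).
Proof.
have [BDl BDr _ _ _ _ _ _] := sc_courant stdE.
have [dataP xx rr xir rxi xixi xxi xix xr rx] := dataE.
rewrite {1}(std_decomposition a) {1}(std_decomposition b).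
rewrite /= !pairE.
rewrite qlie_cD scaler0 addr0 (Omega_conn_l K H) !pairE.
rewrite -(addrA _ (Omega _ _ _ _ _)) (Omega_cD_conn_r dataP).
rewrite !conn_lE !pairE /conn_r !pairE contr_d1_lie.
move: (sfst a) (sfst b) (sfst (ssnd a)) (sfst (ssnd b)) => xi eta r s.
move: (ssnd (ssnd a)) (ssnd (ssnd b)) => x y.
rewrite !(BDl, BDr) xx rr xir rxi xixi xxi xix rx !xr.
rewrite /regroup; apply: spair_eq; rewrite !pairE;
  [apply: spair_eq; rewrite !pairE|].
- by rewrite !(addr0, add0r, subr0).
- by apply: eval_inj => z; rewrite !evalE; ring.
- by apply: (@mpair_inj _ _ _ _ (qmet g)) => t; rewrite !mpairE; ring.
Qed.

Lemma regroup_iso : courant_iso E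
  (matched_sum (twisted H) (qlie_courant g) (conn_r D) (conn_l K)).
Proof.
have [u uE] := @exists_bundle_map _ _ _
  (std_bundle F g) (dsum (dsum F (dual F)) g)
  (fun p w => ((w.2.2, w.1), w.2.1)) (fun p a v w => erefl)
  (fun s => ex_intro _ (regroup s) (fun p => erefl)).
have [u' u'E] := @exists_bundle_map _ _ _
  (dsum (dsum F (dual F)) g) (std_bundle F g)
  (fun p w => (w.1.2, (w.2, w.1.1))) (fun p a v w => erefl)
  (fun s => ex_intro _ (spair (ssnd (sfst s)) (spair (ssnd s) (sfst (sfst s))))
    (fun p => erefl)).
exists u, u'; split.
- by split=> [p [? [? ?]]|p [[? ?] ?]]; rewrite ?uE u'E ?uE.
- move=> p v w; rewrite !uE (sc_metric stdE) /=.
  by [].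
- by move=> p v f; rewrite uE (sc_anchor stdE) /= !addr0.
- have uS s : bmap_sect u s = regroup s by apply: sect_eq => p; exact: uE.
  by move=> a b; rewrite !uS; exact: regroup_bracket.
Qed.

End Regrouping.

Theorem proposition4p21 (R : realType) (n : nat) (M : manifold R n)
    (F : foliation M) (g : qlie_bundle M) (E : courant_str (std_bundle F g))
    (D : Γ F -> Γ g -> Γ g) (K : curvature_map F g) (H : form3 F)
    (stdE : standard_courant E) (dataE : has_data D K H E) (flatE : flat K) :
  matched_pair (twisted H) (qlie_courant g) (conn_r D) (conn_l K) /\
  courant_iso E
    (matched_sum (twisted H) (qlie_courant g) (conn_r D) (conn_l K)).
Proof.
split; first exact: matched_twisted_qlie (hd_data dataE) flatE.
exact: regroup_iso stdE dataE.
Qed.
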